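(* Let $v\in\mathbb N^n$ and put $\mathbb X=x_1+\cdots+x_n$, $\mathbb V=\langle v\rangle_1+\cdots+\langle v\rangle_n$. Then $$\sum_{u\in\mathbb N^n} a^{|u|}\begin{bmatrix}u\\ v\end{bmatrix}\mathsf M_u(x)=a^{|v|}\,\mathsf M_v(x)\prod_{i=1}^n\frac{(a\langle v\rangle_i)_\infty}{(ax_i)_\infty}=a^{|v|}\,\mathsf M_v(x)\;\sigma_a\!\left[\frac{\mathbb X-\mathbb V}{1-q}\right].$$
   Context: Notation. Fix $n\ge 1$, a complex $q$ with $|q|<1$, and $t$, with $q,t$ generic (the coefficients of all polynomials below are rational functions of $q,t$). $\mathbb N=\{0,1,2,\dots\}$, $x=(x_1,\dots,x_n)$. A composition is $u=(u_1,\dots,u_n)\in\mathbb N^n$; $|u|=u_1+\cdots+u_n$; $u^+$ is the weakly decreasing rearrangement of $u$. $(b)_\infty=\prod_{i\ge0}(1-bq^i)$. The spectral vector $\langle u\rangle\in\mathbb C^n$ has entries $\langle u\rangle_i=q^{u_i}t^{k_i}$, where $k_i=\#\{j:u_j<u_i\}+\#\{j>i:u_j=u_i\}$. The diagram of $u$ is the set of $s=(i,j)$ with $1\le i\le n$, $1\le j\le u_i$; for such $s$, $a(s)=u_i-j$ and $l(s)=\#\{k>i: j\le u_k\le u_i\}+\#\{k<i: j\le u_k+1\le u_i\}$. Put $n(u)=\sum_{s\in u}l(s)$, $n'(u)=\sum_i\binom{u_i}{2}$, $c'_u=\prod_{s\in u}(1-q^{a(s)+1}t^{l(s)})$. The interpolation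 Macdonald polynomial $M_u(x)$ is the unique polynomial of degree $|u|$ in $x_1,\dots,x_n$ such that $M_u(\langle v\rangle)=0$ for all $v\in\mathbb N^n$ with $|v|\le|u|$, $v\ne u$, and such that the coefficient of $x^u=x_1^{u_1}\cdots x_n^{u_n}$ is $q^{-n'(u)}$. Its normalised version is $\mathsf M_u(x)=q^{n'(u)}t^{n(u)}M_u(x)/c'_u$. The generalised $q$-binomial coefficient is $\begin{bmatrix}u\\ v\end{bmatrix}=\mathsf M_v(\langle u\rangle)/\mathsf M_v(\langle v\rangle)$. For alphabets (formal sums of letters) $\mathbb A,\mathbb B$, the notation $\sigma_z\!\left[\frac{\mathbb A-\mathbb B}{1-q}\right]$ means $\prod_{b\in\mathbb B}(zb)_\infty\big/\prod_{a\in\mathbb A}(za)_\infty$. The identity is understood as an identity of formal power series in $a$. *)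

(* Defs.v *)
From HB Require Import structures.
From mathcomp Require Import all_boot all_order all_algebra.
From mathcomp Require Import complex.
From mathcomp Require Import boolp classical_sets reals topology normedtype sequences.
(* The notations of mpoly clash with those of mathcomp-analysis: below,
   [multinom n] is 'X_{1..n} and [mpoly n C] is {mpoly C[n]}. *)
From mathcomp Require Import -(notations) mpoly.
Import Order.TTheory GRing.Theory Num.Theory numFieldNormedType.Exports.

Set Implicit Arguments.
Unset Strict Implicit.
Unset Printing Implicit Defensive.

Local Open Scope ring_scope.

(* Formal power series in one variable a: [f k] is the coefficient of a^k. *)
Definition fps (C : Type) : Type := nat -> C.

Section FormalPowerSeries.
Context {C : fieldType}.
Implicit Types f g : fps C.

Definition fps_one : fps C := fun k => (k == 0%N)%:R.

Definition fps_monomial (c : C) (d : nat) : fps C :=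
  fun k => if k == d then c else 0.

Definition fps_mul f g : fps C :=
  fun k => \sum_(i < k.+1) f i * g (k - i)%N.

(* The first k coefficients of 1/f, computed by
   g_k = ([k = 0] - \sum_(i < k) f_(k - i) g_i) / f_0. *)
Fixpoint fps_inv_seq f (k : nat) : seq C :=
  if k is k'.+1 then
    let s := fps_inv_seq f k' in
    rcons s (((k' == 0%N)%:R - \sum_(i < k') f (k' - i)%N * s`_i) / f 0%N)
  else [::].

Definition fps_inv f : fps C := fun k => (fps_inv_seq f k.+1)`_k.

Lemma size_fps_inv_seq f k : size (fps_inv_seq f k) = k.
Proof. by elim: k => //= k IHk; rewrite size_rcons IHk. Qed.

Lemma nth_fps_inv_seq f k i : (i < k)%N -> (fps_inv_seq f k)`_i = fps_inv f i.
Proof.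
elim: k => // k IHk; rewrite ltnS leq_eqVlt => /orP[/eqP -> //|ltik].
by rewrite /= nth_rcons size_fps_inv_seq ltik IHk.
Qed.

Lemma fps_mulVf f : f 0%N != 0 -> fps_mul (fps_inv f) f =1 fps_one.
Proof.
move=> f0 k; rewrite /fps_mul big_ord_recr /= subnn {2}/fps_inv /=.
rewrite nth_rcons size_fps_inv_seq ltnn eqxx divfK //.
rewrite [X in X + _](eq_bigr
  (fun i : 'I_k => f (k - i)%N * (fps_inv_seq f k)`_i)).
  by rewrite addrCA subrr addr0.
by move=> i _; rewrite mulrC nth_fps_inv_seq.
Qed.

(* \sum_(u in N^n) a^|u| c_u *)
Definition fps_sum_multinom (n : nat) (c : multinom n -> C) : fps C :=
  fun k => \sum_(u : bmultinom n k.+1 | mdeg u == k) c u.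

End FormalPowerSeries.

(* (a b)_oo = \prod_(i >= 0) (1 - a b q^i) as a power series in a: each
   coefficient is the limit of the coefficients of the partial products. *)
Definition qpoch (C : numFieldType) (q b : C) : fps C :=
  fun k => limn (fun N => (\prod_(i < N) (1 - (b * q ^+ i) *: 'X : {poly C}))`_k).

(* sigma_a[(A - B) / (1 - q)] as a power series in a *)
Definition sigma (C : numFieldType) (q : C) (A B : seq C) : fps C :=
  fps_mul (\big[fps_mul/fps_one]_(b <- B) qpoch q b)
          (fps_inv (\big[fps_mul/fps_one]_(a <- A) qpoch q a)).

Section Compositions.
Variable n : nat.
Implicit Types u : multinom n.

Definition spectral_exp u (i : 'I_n) : nat :=
  (#|[set j : 'I_n | (u j < u i)%N]|
   + #|[set j : 'I_n | (i < j)%N && (u j == u i)]|)%N.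

(* A box of the diagram of u is (i, j) with 1 <= j <= u i. *)
Definition arm u (i : 'I_n) (j : nat) : nat := (u i - j)%N.

Definition leg u (i : 'I_n) (j : nat) : nat :=
  (#|[set k : 'I_n | (i < k)%N && (j <= u k <= u i)%N]|
   + #|[set k : 'I_n | (k < i)%N && (j <= (u k).+1 <= u i)%N]|)%N.

Definition nstat u : nat :=
  (\sum_(i < n) \sum_(1 <= j < (u i).+1) leg u i j)%N.

Definition nstat' u : nat := (\sum_(i < n) 'C(u i, 2))%N.

End Compositions.

Section Interpolation.
Context {C : numFieldType} (q t : C) (n : nat).
Implicit Types u v : multinom n.

Definition spectral u : 'I_n -> C :=
  fun i => q ^+ u i * t ^+ spectral_exp u i.

Definition c' u : C :=
  \prod_(i < n) \prod_(1 <= j < (u i).+1)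
    (1 - q ^+ (arm u i j).+1 * t ^+ leg u i j).

(* [mmeasure mdeg p] is 1 + the total degree of p (0 if p = 0). *)
Definition is_interp_macdonald u (p : mpoly n C) : Prop :=
  [/\ mmeasure mdeg p = (mdeg u).+1,
      forall v, (mdeg v <= mdeg u)%N -> v != u -> meval (spectral v) p = 0
    & mcoeff u p = q ^- nstat' u].

Definition interp_macdonald u : mpoly n C :=
  xget 0 (is_interp_macdonald u : set (mpoly n C)).

Definition norm_interp_macdonald u : mpoly n C :=
  (q ^+ nstat' u * t ^+ nstat u / c' u) *: interp_macdonald u.

Definition qbinom u v : C :=
  meval (spectral u) (norm_interp_macdonald v)
  / meval (spectral v) (norm_interp_macdonald v).

End Interpolation.

(* Main.v *)
Require Import Defs.
From HB Require Import structures.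
From mathcomp Require Import all_boot all_order all_algebra all_fingroup.
From mathcomp Require Import zify ring.
From mathcomp Require Import complex.
From mathcomp Require Import boolp classical_sets reals topology normedtype sequences.
From mathcomp Require Import -(notations) mpoly.
Import Order.TTheory GRing.Theory Num.Theory numFieldNormedType.Exports.

(* The coefficient of a^k on either side is a polynomial in x of degree at most
   k, and such a polynomial is determined by its values at the points <w> with
   |w| <= k.  At x = <w> the quotient of infinite products telescopes, whenever
   v^+ is contained in w^+, to a polynomial in a of degree |w| - |v|; so both
   sides vanish for |w| < k, and for |w| = k they agree because
     M_u(<u>) = prod_i prod_(j < u_i) (- q^j t^(k_i))
   for the normalised M_u.  This evaluation follows the construction of M_u from
   M_0 = 1 by the raising operator (x_n - 1) p(x_n/q, x_1, ..., x_(n-1)) and by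
   Demazure-Lusztig operators, of which only the step exchanging a zero entry
   with the last nonzero entry is needed.  If v^+ is not contained in w^+ then
   M_v(<w>) = 0 (extra vanishing): M_v is an eigenfunction of Cherednik-type
   operators, and evaluating the eigenvalue equation at <w> expresses
   (<w>_i/<v>_i - 1) M_v(<w>) through values M_v(<w'>), with w' obtained from w
   by lowering one entry and permuting. *)

Set Implicit Arguments.
Unset Strict Implicit.
Unset Printing Implicit Defensive.

Local Open Scope ring_scope.

(** * Compositions *)

Lemma card_set_sum (T : finType) (P : pred T) :
  #|[set x | P x]| = (\sum_x (P x : nat))%N.
Proof.
rewrite cardsE -sum1_card big_mkcond; apply: eq_bigr => x _.
by rewrite unfold_in; case: (P x).
Qed.

Section Compositions.
Context {n : nat}.
Implicit Types (u v w : multinom n) (i j k : 'I_n).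

Definition mperm (s : 'S_n) u : multinom n := Multinom [tuple u (s i) | i < n].

Lemma mpermE s u i : mperm s u i = u (s i).
Proof. exact: mnmE. Qed.

Lemma mperm_tpermK i j : involutive (mperm (tperm i j)).
Proof. by move=> u; apply/mnmP => k; rewrite !mpermE tpermK. Qed.

Lemma mdeg_mperm s u : mdeg (mperm s u) = mdeg u.
Proof.
rewrite !mdegE [RHS](reindex_inj (@perm_inj _ s)) /=.
by apply: eq_bigr => i _; rewrite mpermE.
Qed.

(* Position [j] precedes [i] in the order for which [spectral_exp u i] is the
   rank of [i]. *)
Definition below u j i := (u j < u i)%N || ((u j == u i) && (i < j)%N).

Lemma spectral_expE u i : spectral_exp u i = (\sum_j (below u j i : nat))%N.
Proof.
rewrite /spectral_exp !card_set_sum -big_split; apply: eq_bigr => j _ /=.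
by rewrite /below; lia.
Qed.

Lemma leg_sum u i (j : nat) :
  leg u i j = (\sum_(k < n) (((i < k) && (j <= u k <= u i))%N
                     + ((k < i) && (j <= (u k).+1 <= u i))%N))%N.
Proof. by rewrite /leg !card_set_sum -big_split. Qed.

Lemma below_total u i j : i != j -> below u i j || below u j i.
Proof. by rewrite -val_eqE /below /=; lia. Qed.

Lemma spectral_exp_lt u i j : below u j i -> (spectral_exp u j < spectral_exp u i)%N.
Proof.
move=> ji; rewrite !spectral_expE (bigD1 j) //= [ltnRHS](bigD1 j) //=.
have -> : below u j j = false by rewrite /below; lia.
rewrite ji add0n add1n ltnS; apply: leq_sum => k _.
by move: ji; rewrite /below; lia.
Qed.

Lemma spectral_exp_inj u : injective (spectral_exp u).
Proof.
move=> i j eij; apply/eqP/negPn/negP => /(below_total u).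
by case/orP => /spectral_exp_lt; rewrite eij ltnn.
Qed.

Lemma ltn_spectral_exp u i : (spectral_exp u i < n)%N.
Proof.
rewrite spectral_expE (bigD1 i) //=.
have -> : below u i i = false by rewrite /below; lia.
rewrite add0n (@leq_ltn_trans (\sum_(j < n | j != i) 1)%N) //.
  by apply: leq_sum => j _; case: below.
by rewrite sum1_card cardC1 card_ord; case: n i => [[]|].
Qed.

Definition spectral_ord u i : 'I_n := Ordinal (ltn_spectral_exp u i).

Lemma spectral_ord_inj u : injective (spectral_ord u).
Proof. by move=> i j /(congr1 val) /spectral_exp_inj. Qed.

Lemma spectral_exp_reindex u v (f : 'I_n -> 'I_n) i :
    injective f -> (forall j, below u j i = below v (f j) (f i)) ->
  spectral_exp u i = spectral_exp v (f i).
Proof.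
move=> finj fb; rewrite !spectral_expE [RHS](reindex_inj finj).
by apply: eq_bigr => j _; rewrite fb.
Qed.

Section AdjacentSwap.
Variables (i j : 'I_n) (ij : j = i.+1 :> nat).

Let neq_ij : i != j.
Proof. by rewrite -val_eqE /= ij; lia. Qed.

Lemma tperm_val k : tperm i j k = (if k == i then j else if k == j then i else k).
Proof.
case: tpermP => [->|->|/eqP/negPf-> /eqP/negPf->] //; rewrite ?eqxx //.
by rewrite eq_sym (negPf neq_ij).
Qed.

(** No position lies strictly between [i] and [j] and their entries differ, so the exchange
    preserves the order of every pair of positions. *)
Lemma spectral_exp_swap u k : u i != u j ->
  spectral_exp (mperm (tperm i j) u) k = spectral_exp u (tperm i j k).
Proof.
move=> uij; apply: spectral_exp_reindex => [|l]; first exact: perm_inj.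
rewrite /below !mpermE; move: uij.
by case: (tpermP i j k) => [->|->|/eqP + /eqP +]; case: (tpermP i j l) => [->|->|/eqP + /eqP +];
   rewrite -?val_eqE /=; lia.
Qed.

(** Nothing can be ranked between two equal neighbours. The resulting factor t between their
    spectral values is what the factor x_i - t x_j of [demazure] detects. *)
Lemma spectral_exp_eqS u : u i = u j -> spectral_exp u i = (spectral_exp u j).+1.
Proof.
move=> uij; rewrite !spectral_expE (bigD1 j) //= [in RHS](bigD1 j) //=.
have -> : below u j j = false by rewrite /below; lia.
have -> : below u j i by rewrite /below uij; lia.
rewrite add1n; congr _.+1; apply: eq_bigr => k; rewrite -val_eqE /below uij /=.
by move=> kj; congr (nat_of_bool (_ || (_ && _))); lia.
Qed.

End AdjacentSwap.

(* Equivalent to the inclusion of partitions [u^+] in [w^+]. *)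
Definition mnm_dom u w := exists s : 'S_n, forall i, (u i <= w (s i))%N.

Lemma mnm_dom_refl u : mnm_dom u u.
Proof. by exists 1%g => i; rewrite perm1. Qed.

Lemma mnm_dom_trans v u w : mnm_dom u v -> mnm_dom v w -> mnm_dom u w.
Proof.
move=> [s us] [s' vs]; exists (s * s')%g => i.
by rewrite permM (leq_trans (us i)).
Qed.

Lemma mnm_dom_mperm s u w : mnm_dom (mperm s u) w <-> mnm_dom u w.
Proof.
split=> [[s' us]|[s' us]]; [exists (s^-1 * s')%g | exists (s * s')%g] => i.
  by rewrite permM; have := us (s^-1 i)%g; rewrite mpermE permKV.
by rewrite permM mpermE.
Qed.

(** Pigeonhole: if w_j < u_i, then [s] maps the positions ranked at least as high as [i] in [u]
    injectively into those ranked strictly above [j] in [w], and there is one fewer of the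
    latter. *)
Lemma mnm_dom_sorted u w i j : mnm_dom u w ->
  spectral_exp u i = spectral_exp w j -> (u i <= w j)%N.
Proof.
move=> [s us] eij; rewrite leqNgt; apply/negP => lt_wu.
pose A := [set k | spectral_exp u i <= spectral_exp u k]%N.
pose B := [set k | spectral_exp w j < spectral_exp w k]%N.
have sAB : s @: A \subset B.
  apply/fintype.subsetP => y /imsetP[k kA ->]; move: kA; rewrite !inE => ik.
  apply: spectral_exp_lt; rewrite /below; apply/orP; left.
  apply: (leq_trans lt_wu); apply: leq_trans (us k).
  rewrite leqNgt; apply/negP => lt_ki.
  have: below u k i by rewrite /below lt_ki.
  by move/spectral_exp_lt; rewrite ltnNge ik.
(* The ranks run through 0, ..., n - 1 exactly once, so such a count depends only on the set of
   ranks. *)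
have card_up v (P : pred nat) : #|[set k | P (spectral_exp v k)]| = #|[set k : 'I_n | P k]|.
  rewrite -[LHS](card_imset _ (@spectral_ord_inj v)); apply: eq_card => k.
  apply/imsetP/idP => [[l]|]; rewrite !inE; first by move=> ? ->.
  have [g _ gK] := injF_bij (@spectral_ord_inj v).
  by move=> Pk; exists (g k); rewrite ?gK // inE
    -[spectral_exp _ _]/(val (spectral_ord v (g k))) gK.
have := subset_leq_card sAB; rewrite card_imset; last exact: perm_inj.
have -> := card_up u (fun k : nat => spectral_exp u i <= k)%N.
have -> := card_up w (fun k : nat => spectral_exp w j < k)%N; rewrite eij.
apply/negP; rewrite -ltnNge; apply: proper_card.
apply/properP; split; first by apply/fintype.subsetP => k; rewrite !inE => /ltnW.
by exists (spectral_ord w j); rewrite !inE ?ltnn /=.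
Qed.

(** Matching equal ranks makes the powers of t in the two spectral vectors agree, so that matched
    entries differ by a power of q only. *)
Lemma mnm_dom_perm u w : mnm_dom u w -> exists s : 'S_n,
  (forall i, u i <= w (s i))%N /\ forall i, spectral_exp u i = spectral_exp w (s i).
Proof.
move=> uw; have [g gK Kg] := injF_bij (@spectral_ord_inj w).
have sinj : injective (g \o spectral_ord u).
  by apply: inj_comp (can_inj Kg) (@spectral_ord_inj u).
exists (perm sinj); have e i : spectral_exp u i = spectral_exp w (perm sinj i).
  by rewrite permE /= -[RHS]/(val (spectral_ord w _)) Kg.
by split => // i; apply: mnm_dom_sorted uw (e i).
Qed.

End Compositions.

(** * Rotation of a composition and its effect on ranks, arms and legs *)

Section Raising.
Context {m : nat}.
Implicit Types (u v w : multinom m.+1) (i j k : 'I_m.+1).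

Lemma ordS_val i : ordS i = (if i == ord_max then 0%N else i.+1) :> nat.
Proof.
rewrite /= -val_eqE /=; case: eqVneq => [->|ne]; first by rewrite modnn.
by rewrite modn_small // ltn_neqAle eqSS ne ltn_ord.
Qed.

Definition mraise u : multinom m.+1 :=
  Multinom [tuple (u (ordS i) + (i == ord_max))%N | i < m.+1].

(** The subtraction is truncated, so this inverts [mraise] only on compositions whose last entry is
    nonzero. *)
Definition mlower u : multinom m.+1 :=
  Multinom [tuple (u (ord_pred i) - (i == ord0))%N | i < m.+1].

Lemma mraiseE u i : mraise u i = (u (ordS i) + (i == ord_max))%N.
Proof. exact: mnmE. Qed.

Lemma mlowerE u i : mlower u i = (u (ord_pred i) - (i == ord0))%N.
Proof. exact: mnmE. Qed.

Lemma ordS_max : ordS (@ord_max m) = ord0.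
Proof. by apply: val_inj; rewrite /= modnn. Qed.

Lemma ordS_eq0 i : (ordS i == ord0) = (i == ord_max).
Proof. by rewrite -ordS_max (inj_eq (@ordS_inj _)). Qed.

Lemma mlowerK u : u ord_max != 0%N -> mraise (mlower u) = u.
Proof.
move=> um; apply/mnmP => i; rewrite mraiseE mlowerE ordSK ordS_eq0.
by case: eqP => [->|]; lia.
Qed.

Lemma mdeg_mraise u : mdeg (mraise u) = (mdeg u).+1.
Proof.
rewrite !mdegE [X in _ = X.+1](reindex_inj (@ordS_inj m.+1)).
rewrite -[(\sum_j _).+1]addn1.
rewrite (eq_bigr (fun i => (u (ordS i) + (i == ord_max))%N)); last first.
  by move=> i _; rewrite mraiseE.
by rewrite big_split /= -(big_mkcond (pred1 ord_max) (fun=> 1%N)) big_pred1_eq.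
Qed.

Lemma mlower_dom u : mnm_dom (mlower u) u.
Proof.
have pinj : injective (@ord_pred m.+1) by apply: (can_inj (@ord_predK _)).
by exists (perm pinj) => i; rewrite permE mlowerE leq_subr.
Qed.

(** Among equal entries the earlier position ranks higher. A first entry a thus ranks above all
    other entries a and below all entries a + 1; moved to the end and raised to a + 1, it keeps that
    place. *)
Lemma below_mraise u i j : below (mraise u) j i = below u (ordS j) (ordS i).
Proof.
rewrite /below !mraiseE !ordS_val.
have := ltn_ord i; have := ltn_ord j.
by case: (eqVneq j ord_max) => [->|]; case: (eqVneq i ord_max) => [->|];
   rewrite -?val_eqE ?ordS_max /=; lia.
Qed.

Lemma spectral_exp_mraise u i : spectral_exp (mraise u) i = spectral_exp u (ordS i).
Proof. apply: spectral_exp_reindex => [|j]; [exact: ordS_inj | exact: below_mraise]. Qed.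

Lemma spectral_exp_max0 u : u ord_max = 0%N -> spectral_exp u ord_max = 0%N.
Proof.
move=> u0; rewrite spectral_expE big1 // => j _.
by rewrite /below u0 /=; have := leq_ord j; lia.
Qed.

Lemma nstat'_mraise u : nstat' (mraise u) = (nstat' u + u ord0)%N.
Proof.
rewrite /nstat' [in RHS](reindex_inj (@ordS_inj _)) /=.
rewrite [in LHS](bigD1 ord_max) // [in RHS](bigD1 ord_max) //=.
rewrite !mraiseE ordS_max eqxx addn1 binS bin1.
rewrite -!addnA; congr (_ + _)%N; rewrite addnC; congr (_ + _)%N.
by apply: eq_bigr => i /negPf ne; rewrite mraiseE ne addn0.
Qed.

Lemma leg_mraise u i (x : nat) : i != ord_max -> leg (mraise u) i x = leg u (ordS i) x.
Proof.
move=> im; rewrite !leg_sum [in RHS](reindex_inj (@ordS_inj _)); apply: eq_bigr => k _.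
rewrite !mraiseE !ordS_val (negPf im); move: im; rewrite -val_eqE /= => im.
have := ltn_ord i; case: eqVneq => [->|]; rewrite -?val_eqE /= ?addn0 ?addn1; first by lia.
by lia.
Qed.

Lemma leg_mraise_max u (x : nat) : (0 < x)%N -> leg (mraise u) ord_max x.+1 = leg u ord0 x.
Proof.
move=> x0; rewrite !leg_sum [in RHS](reindex_inj (@ordS_inj _)); apply: eq_bigr => k _.
rewrite !mraiseE !ordS_val eqxx ordS_max.
have := ltn_ord k; case: eqVneq => [->|]; rewrite -?val_eqE /= ?addn0 ?addn1; first by lia.
by lia.
Qed.

Lemma leg_mraise_max1 u : leg (mraise u) ord_max 1 = spectral_exp u ord0.
Proof.
rewrite leg_sum spectral_expE [in RHS](reindex_inj (@ordS_inj _)); apply: eq_bigr => k _.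
rewrite !mraiseE /below !ordS_val eqxx ordS_max.
have := ltn_ord k; case: eqVneq => [->|]; rewrite -?val_eqE /= ?ordS_max ?addn0 ?addn1; by lia.
Qed.

(** The diagram gains one box, the first of the last row, whose arm is u_1 and whose leg is the rank
    of the first position; all other boxes keep arm and leg. The general [op] serves both the
    product [c'] and the sum [nstat]. *)
Lemma prod_boxes_mraise (R : Type) (idx : R) (op : Monoid.com_law idx)
    (F : nat -> nat -> R) u :
  \big[op/idx]_(i < m.+1) \big[op/idx]_(1 <= j < (mraise u i).+1)
     F (arm (mraise u) i j) (leg (mraise u) i j)
  = op (F (u ord0) (spectral_exp u ord0))
     (\big[op/idx]_(i < m.+1) \big[op/idx]_(1 <= j < (u i).+1)
        F (arm u i j) (leg u i j)).
Proof.
rewrite [in RHS](reindex_inj (@ordS_inj _)) /=.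
rewrite (bigD1 ord_max) //= [in RHS](bigD1 ord_max) //= Monoid.mulmA; congr (op _ _).
  rewrite mraiseE eqxx addn1 big_nat_recl // ordS_max leg_mraise_max1.
  rewrite /arm mraiseE eqxx ordS_max addn1 subSS subn0; congr (op _ _).
  rewrite [RHS]big_nat_cond [LHS]big_nat_cond; apply: eq_bigr => j /andP[/andP[j1 _] _].
  by rewrite subSS leg_mraise_max.
apply: eq_bigr => i im; rewrite /arm mraiseE (negPf im) addn0.
by apply: eq_bigr => j _; rewrite leg_mraise.
Qed.

Lemma nstat_mraise u : nstat (mraise u) = (nstat u + spectral_exp u ord0)%N.
Proof. by rewrite addnC /nstat (prod_boxes_mraise _ (fun _ l => l)). Qed.

End Raising.

(** * Moving the last nonzero entry one step left, past a zero *)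

Section LoweringSwap.
Context {n : nat} (u : multinom n) (i j : 'I_n).
Hypotheses (ij : j = i.+1 :> nat) (ui0 : u i = 0%N) (uj0 : (0 < u j)%N).
Hypothesis (utail : forall k : 'I_n, (j < k)%N -> u k = 0%N).

Let u' := mperm (tperm i j) u.

Let neq_ij : i != j.
Proof. by rewrite -val_eqE /= ij; lia. Qed.

Lemma leg_swap_row (k : 'I_n) x : (k < i)%N -> leg u' k x = leg u k x.
Proof.
move=> ki; rewrite !leg_sum [in RHS](reindex_inj (@perm_inj _ (tperm i j))) /=.
apply: eq_bigr => l _; rewrite /u' !mpermE !(tperm_val ij) -!val_eqE.
have -> : (val k == val i) = false by rewrite /=; lia.
have -> : (val k == val j) = false by rewrite /= ij; lia.
rewrite !val_eqE -(tperm_val ij).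
by case: (tpermP i j l) => [->|->|/eqP + /eqP +]; rewrite -?val_eqE /= ?ij; lia.
Qed.

(** In [u] the zero at [i] lies to the left of row [j], where only the leg of the first box counts
    it; after the exchange it lies to the right and is not counted. *)
Lemma leg_swap x : (0 < x <= u j)%N -> leg u j x = (leg u' i x + (x == 1))%N.
Proof.
move=> xj; rewrite !leg_sum -(big_pred1_eq addn i (fun=> nat_of_bool (x == 1%N))).
rewrite [in X in (_ + X)%N]big_mkcond -big_split; apply: eq_bigr => k _ /=.
rewrite /u' !mpermE !(tperm_val ij) -!val_eqE eqxx /=.
case: (ltngtP k i) => ki.
- have -> : (val k == val j) = false by rewrite /= ij; lia.
  by lia.
- case: (eqVneq (val k) (val j)) => [/val_inj->|kj]; first by rewrite ui0 ; lia.
  by rewrite utail; move: kj; rewrite /=; lia.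
- by move/val_inj: ki ->; rewrite ui0 ij; lia.
Qed.

(** The positions ranked below [j] are those on its left with smaller entries, counted by the leg of
    its first box, and the zeros on its right, which are exactly the positions ranked below [i]. *)
Lemma spectral_exp_swap_leg : spectral_exp u j = (leg u j 1 + spectral_exp u i)%N.
Proof.
rewrite !spectral_expE leg_sum -big_split; apply: eq_bigr => k _ /=.
rewrite /below; case: (ltngtP k j) => kj.
- case: (ltngtP k i) => ki; [by rewrite ui0; lia | by lia |].
  by move/val_inj: ki ->; rewrite ui0 ; lia.
- by rewrite utail // ui0; lia.
- by move/val_inj: kj ->; rewrite ui0 ij; lia.
Qed.

(** Only the first box of the moved row changes its leg. As [op] need not have inverses, its two
    factors are placed crosswise. *)
Lemma prod_boxes_swap (R : Type) (idx : R) (op : Monoid.com_law idx)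
    (F : nat -> nat -> R) :
  op (F (u j).-1 (leg u' i 1).+1)
  (\big[op/idx]_(k < n) \big[op/idx]_(1 <= x < (u' k).+1) F (arm u' k x) (leg u' k x))
  = op (F (u j).-1 (leg u' i 1))
  (\big[op/idx]_(k < n) \big[op/idx]_(1 <= x < (u k).+1) F (arm u k x) (leg u k x)).
Proof.
rewrite [in RHS](reindex_inj (@perm_inj _ (tperm i j))) /=.
rewrite (bigD1 i) //= [in RHS](bigD1 i) //= tpermL !Monoid.mulmA; congr (op _ _).
  have -> : u' i = u j by rewrite /u' mpermE tpermL.
  rewrite (@big_ltn _ _ _ 1) // [in RHS](@big_ltn _ _ _ 1) // !Monoid.mulmA.
  rewrite /arm; have -> : u' i = u j by rewrite /u' mpermE tpermL.
  rewrite (leg_swap (x := 1)) ?subn1 ?addn1; last by lia.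
  have opC a b : op a b = op b a by exact: Monoid.mulmC.
  apply: congr2; first exact: opC.
  rewrite big_nat_cond [RHS]big_nat_cond; apply: eq_bigr => x xr.
  rewrite leg_swap; last by lia.
  by have -> : (x == 1)%N = false; [lia | rewrite addn0].
apply: eq_bigr => k ki; have -> : u' k = u (tperm i j k) by rewrite /u' mpermE.
rewrite tperm_val // (negPf ki); case: eqVneq => [kj|kj].
  by rewrite ui0 !big_geq.
case: (ltngtP k i) => [lki||/val_inj kei]; last by rewrite kei eqxx in ki.
  apply: eq_bigr => x _; rewrite leg_swap_row // /arm /u' mpermE.
  by rewrite tperm_val // (negPf ki) (negPf kj).
move=> lik; have -> : u k = 0%N by apply: utail; move: kj; rewrite -val_eqE /= ij; lia.
by rewrite !big_geq.
Qed.

Lemma nstat_swap : nstat u = (nstat u').+1.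
Proof.
have : ((leg u' i 1).+1 + nstat u' = leg u' i 1 + nstat u)%N.
  exact: (prod_boxes_swap _ (fun _ l => l)).
by lia.
Qed.

Lemma nstat'_swap : nstat' u' = nstat' u.
Proof.
rewrite /nstat' [RHS](reindex_inj (@perm_inj _ (tperm i j))) /=.
by apply: eq_bigr => k _; rewrite /u' mpermE.
Qed.

End LoweringSwap.

(** Induction on the degree, then on the distance of the last nonzero entry from the end. If that
    entry stands at the end, [u] is a value of [mraise]; otherwise exchanging it with the zero on
    its right brings it nearer to the end, and the last premise undoes the exchange. *)
Lemma mnm_raise_swap_ind m (P : multinom m.+1 -> Prop) :
    P mnm0 -> (forall u, P u -> P (mraise u)) ->
    (forall (u : multinom m.+1) (i j : 'I_m.+1), j = i.+1 :> nat -> u i = 0%N -> (0 < u j)%N ->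
       (forall k : 'I_m.+1, (j < k)%N -> u k = 0%N) -> P u -> P (mperm (tperm i j) u)) ->
  forall u, P u.
Proof.
move=> P0 PR PS u; move ed : (mdeg u) => d; elim: d u ed => [|d IHd] u ed.
  by move/eqP: ed; rewrite mdeg_eq0 => /eqP->.
have {ed} [k ek] : exists k : 'I_m.+1, mdeg u = d.+1 /\ u k != 0%N /\
    forall l : 'I_m.+1, (k < l)%N -> u l = 0%N.
  have [i0 ui0] : exists i, u i != 0%N.
    apply/existsP; apply: contra_eqT ed; rewrite negb_exists => /forallP u0.
    by rewrite mdegE big1 // => i _; have := u0 i; rewrite negbK => /eqP.
  case: (@arg_maxnP _ i0 (fun i => u i != 0%N) val ui0) => k uk kmax.
  exists k; split=> //; split=> // l kl; apply/eqP; rewrite -[_ == _]negbK.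
  by apply/negP => /kmax; rewrite /= leqNgt kl.
move ec : (m - k)%N => c; elim: c u k ek ec => [|c IHc] u k [ed [uk ktail]] ec.
  have km : k = ord_max by apply: val_inj; rewrite /=; have := leq_ord k; lia.
  rewrite km in uk; rewrite -(mlowerK uk); apply/PR/IHd.
  by apply: succn_inj; rewrite -ed -[in RHS](mlowerK uk) mdeg_mraise.
have ltk : (k.+1 < m.+1)%N by lia.
pose k1 := Ordinal ltk; have kk1 : k1 = k.+1 :> nat by [].
rewrite -[u](mperm_tpermK k k1); have uk1 : u k1 = 0%N by apply: ktail; rewrite /=.
have e0 : mperm (tperm k k1) u k = 0%N by rewrite mpermE tpermL.
have e1 : mperm (tperm k k1) u k1 = u k by rewrite mpermE tpermR.
have et (l : 'I_m.+1) : (k1 < l)%N -> mperm (tperm k k1) u l = 0%N.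
  move=> kl; rewrite mpermE tpermD ?ktail //; try by rewrite -val_eqE /= in kl *; lia.
  by move: kl; rewrite /=; lia.
apply: PS => //; first by rewrite e1; lia.
apply: (IHc _ k1); last by rewrite /=; lia.
by rewrite mdeg_mperm e1; split => //; split.
Qed.

(** * Operators on polynomials *)

Local Notation msize := (mmeasure mdeg).
Local Notation mvar i := (mpolyX _ (mnm1 i)).

Section MPolyFacts.
Context {C : fieldType} {n : nat}.
Implicit Types (p g : mpoly n C) (w : multinom n) (i j : 'I_n) (y : 'I_n -> C).

Lemma msize_leP p d :
  (forall w, (d <= mdeg w)%N -> mcoeff w p = 0) <-> (msize p <= d)%N.
Proof.
split=> [pd|pd w dw]; last first.
  by apply: memN_msupp_eq0; apply: msize_mdeg_ge; apply: leq_trans dw.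
rewrite msizeE; apply/bigmax_leqP_seq => w; rewrite mcoeff_msupp => pw _.
by rewrite ltnNge; apply/negP => /pd; apply/eqP.
Qed.

Lemma msize_gt_mdeg p w : mcoeff w p != 0 -> (mdeg w < msize p)%N.
Proof. by rewrite -mcoeff_msupp; apply: msize_mdeg_lt. Qed.

Lemma msizeM_le_add p g d e :
  (msize p <= d.+1)%N -> (msize g <= e)%N -> (msize (p * g) <= d + e)%N.
Proof.
have [->|p0] := eqVneq p 0; first by rewrite mul0r mmeasure0.
have [->|g0] := eqVneq g 0; first by rewrite mulr0 mmeasure0.
by move=> pd ge; rewrite msizeM // -subn1 leq_subLR addnA add1n leq_add.
Qed.

Lemma msizeD_le_max p g d :
  (msize p <= d)%N -> (msize g <= d)%N -> (msize (p + g) <= d)%N.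
Proof. by move=> pd gd; apply: leq_trans (mmeasureD_le _ _ _) _; rewrite geq_max pd. Qed.

Lemma msizeZ_le_trans c p d : (msize p <= d)%N -> (msize (c *: p) <= d)%N.
Proof. exact: leq_trans (mmeasureZ_le _ _ _). Qed.

Lemma msize_mvar i : msize (mvar i : mpoly n C) = 2%N.
Proof. by rewrite msizeX mdeg1. Qed.

Lemma mcoeff_mvar_mul0 i p w : w i = 0%N -> mcoeff w (mvar i * p) = 0.
Proof.
move=> wi; rewrite mcoeffM big1 // => k /eqP wk.
rewrite mcoeffX; case: eqP => [ek|_]; last by rewrite mul0r.
by have := congr1 (fun v => fun_of_multinom v i) wk; rewrite mnmDE -ek mnm1E eqxx wi.
Qed.

Lemma mcoeff_mvar_mul i p w : mcoeff (mnm_add (mnm1 i) w) (mvar i * p) = mcoeff w p.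
Proof. by rewrite mulrC mcoeffMX. Qed.

Lemma mvar_div i p : (forall w, w i = 0%N -> mcoeff w p = 0) ->
  exists g, p = mvar i * g.
Proof.
move=> pi0; exists (\sum_(w <- msupp p) mcoeff w p *: mpolyX _ (mnm_sub w (mnm1 i))).
rewrite {1}[p]mpolyE mulr_sumr big_seq [RHS]big_seq; apply: eq_bigr => w.
rewrite mcoeff_msupp => pw; rewrite -scalerAr -mpolyXD addmC submK //.
by rewrite lep1mP; apply: contraNneq pw => /pi0 ->.
Qed.

Lemma meval_msym (s : 'S_n) p y : meval y (msym s p) = meval (y \o s) p.
Proof.
elim/mpolyind: p => [|c w p _ _ IH]; first by rewrite msym0 !meval0.
rewrite msymD msymZ !mevalD !mevalZ IH msymX !mevalX; congr (_ * _ + _).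
rewrite (reindex_inj (@perm_inj _ s)) /=.
by apply: eq_bigr => i _; rewrite mnmE permK.
Qed.

Lemma msize_msym (s : 'S_n) p d : (msize p <= d)%N -> (msize (msym s p) <= d)%N.
Proof.
move/msize_leP => pd; apply/msize_leP => w dw.
by rewrite mcoeff_sym pd // -[mdeg _]/(mdeg (mperm s w)) mdeg_mperm.
Qed.

(** Divisibility holds for the variables, passes to products by the twisted Leibniz rule, and to all
    polynomials by linearity. *)
Lemma divided_difference_ex i j p : exists g, (mvar i - mvar j) * g = p - msym (tperm i j) p.
Proof.
pose P p := exists g, (mvar i - mvar j) * g = p - msym (tperm i j) p.
have P1 : P 1 by exists 0; rewrite msym1 subrr mulr0.
have PM p1 p2 : P p1 -> P p2 -> P (p1 * p2).
  move=> [g1 e1] [g2 e2]; exists (g1 * p2 + msym (tperm i j) p1 * g2).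
  by rewrite mulrDr mulrA e1 mulrCA e2 msymM; ring.
have PX k : P (mvar k).
  rewrite /P msymX tpermV.
  have -> : Multinom [tuple fun_of_multinom (mnm1 k) (tperm i j l) | l < n]
          = mnm1 (tperm i j k).
    by apply/mnmP => l; rewrite mnmE !mnm1E -(inj_eq (@perm_inj _ (tperm i j))) tpermK.
  case: tpermP => [->|->|_ _].
  - by exists 1; rewrite mulr1.
  - by exists (-1); rewrite mulrN1 opprB.
  - by exists 0; rewrite mulr0 subrr.
elim/mpolyind: p => [|c w p _ _ [g eg]]; first by exists 0; rewrite mulr0 msym0 subr0.
have [h eh] : P (mpolyX _ w).
  rewrite mpolyXE_id; apply: (big_ind P) => // k _.
  by elim: (w k) => [|e IHe]; rewrite ?expr0 ?exprS //; apply: PM.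
exists (c *: h + g); rewrite mulrDr -scalerAr eh eg msymD msymZ scalerBr.
by rewrite addrACA opprD.
Qed.

(** A quotient always exists, so the default 0 of [xget] is never taken; for distinct [i] and [j]
    the quotient is unique. *)
Definition divided_difference i j p : mpoly n C :=
  xget 0 [set g | (mvar i - mvar j) * g = p - msym (tperm i j) p]%classic.

Lemma divided_differenceE i j p :
  (mvar i - mvar j) * divided_difference i j p = p - msym (tperm i j) p.
Proof.
have [g eg] := divided_difference_ex i j p.
by rewrite /divided_difference; case: xgetP => [h _ //|/(_ g)].
Qed.

Lemma mvarB_neq0 i j : i != j -> mvar i - mvar j != 0 :> mpoly n C.
Proof.
move=> ij; apply: contra_neq (@oner_neq0 C) => /(congr1 (mcoeff (mnm1 i))).
by rewrite mcoeffB !mcoeffX eqxx eq_mnm1 eq_sym (negPf ij) subr0 mcoeff0.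
Qed.

Lemma msize_divided_difference i j p d : i != j -> (msize p <= d)%N ->
  (msize (divided_difference i j p) <= d.-1)%N.
Proof.
move=> ij pd; set g := divided_difference i j p.
have [->|g0] := eqVneq g 0; first by rewrite mmeasure0.
have := congr1 msize (divided_differenceE i j p); rewrite msizeM ?mvarB_neq0 //.
have : (msize (p - msym (tperm i j) p) <= d)%N.
  by apply: msizeD_le_max => //; rewrite mmeasureN msize_msym.
have : (1 < msize (mvar i - mvar j : mpoly n C))%N.
  rewrite -[1%N](mdeg1 i) msize_gt_mdeg //.
  by rewrite mcoeffB !mcoeffX eqxx eq_mnm1 (eq_sym j) (negPf ij) subr0 oner_eq0.
move=> h1 h2 e; rewrite -e in h2; move: h1 h2; rewrite -/g.
by move: (msize _) (msize g) => a b; lia.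
Qed.

End MPolyFacts.

Section Demazure.
Context {C : fieldType} (t : C) {n : nat}.
Implicit Types (p g : mpoly n C) (w : multinom n) (i j : 'I_n) (y : 'I_n -> C).

(* The Demazure-Lusztig operator
   p |-> (x_i - t x_j) (p - s_ij p) / (x_i - x_j). *)
Definition demazure i j p : mpoly n C :=
  (mvar i - t *: mvar j) * divided_difference i j p.

Lemma meval_demazure i j p y : y i != y j ->
  meval y (demazure i j p)
  = (y i - t * y j) / (y i - y j) * (meval y p - meval (y \o tperm i j) p).
Proof.
move=> yij; have := congr1 (meval y) (divided_differenceE i j p).
rewrite !mevalM !mevalB mevalZ !mevalXU meval_msym => <-.
by field; rewrite subr_eq0.
Qed.

(** For a monomial free of x_j the factors x_i - t x_j and x_i - x_j contribute equally, so the
    denominator cancels at the level of coefficients. For one free of x_i the contributions differ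
    by a factor t. *)
Lemma mcoeff_demazure_r i j p w : w j = 0%N ->
  mcoeff w (demazure i j p) = mcoeff w p - mcoeff (mperm (tperm i j) w) p.
Proof.
move=> wj; rewrite -[RHS]/(mcoeff w p - mcoeff (Multinom _) p) -mcoeff_sym -mcoeffB.
rewrite -divided_differenceE /demazure !mulrBl !mcoeffB -scalerAl mcoeffZ.
by rewrite !(mcoeff_mvar_mul0 _ wj) mulr0.
Qed.

Lemma mcoeff_demazure_l i j p w : w i = 0%N ->
  mcoeff w (demazure i j p) = t * (mcoeff w p - mcoeff (mperm (tperm i j) w) p).
Proof.
move=> wi; rewrite -[mcoeff (mperm _ _) p]/(mcoeff (Multinom _) p) -mcoeff_sym -mcoeffB.
rewrite -divided_differenceE /demazure !mulrBl !mcoeffB -scalerAl mcoeffZ.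
by rewrite !(mcoeff_mvar_mul0 _ wi) !sub0r mulrN.
Qed.

Lemma msize_demazure i j p d : i != j -> (msize p <= d)%N -> (msize (demazure i j p) <= d)%N.
Proof.
move=> ij; case: d => [|d pd].
  rewrite leqn0 mmeasure_poly_eq0 => /eqP->.
  suff -> : demazure i j 0 = 0 by rewrite mmeasure0.
  have := divided_differenceE i j (0 : mpoly n C); rewrite msym0 subrr => /eqP.
  by rewrite mulf_eq0 (negPf (mvarB_neq0 ij)) /= => /eqP; rewrite /demazure => ->; rewrite mulr0.
rewrite -add1n; apply: msizeM_le_add; last exact: (@msize_divided_difference _ _ _ _ _ d.+1).
by apply: msizeD_le_max; rewrite ?mmeasureN ?msizeZ_le_trans ?msize_mvar.
Qed.

End Demazure.

Section Raise.
Context {C : fieldType} (q : C) {m : nat}.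
Implicit Types (p g : mpoly m.+1 C) (w u : multinom m.+1) (y : 'I_m.+1 -> C).

Lemma ord_pred_inj : injective (@ord_pred m.+1).
Proof. exact: can_inj (@ord_predK _). Qed.

Definition cyc : 'S_m.+1 := perm ord_pred_inj.

Lemma cycE i : cyc i = ord_pred i.
Proof. exact: permE. Qed.

Lemma cyc0 : cyc ord0 = ord_max.
Proof. by rewrite cycE -ordS_max ordSK. Qed.

Definition rescale p : mpoly m.+1 C :=
  \sum_(w <- msupp p) (mcoeff w p * q ^- w ord0) *: mpolyX _ w.

Lemma mcoeff_rescale w p : mcoeff w (rescale p) = mcoeff w p * q ^- w ord0.
Proof.
rewrite raddf_sum /=; have [wp|wp] := boolP (w \in msupp p).
  rewrite (bigD1_seq w) //= mcoeffZ mcoeffX eqxx mulr1 big1 ?addr0 // => w' /negPf ne.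
  by rewrite mcoeffZ mcoeffX ne mulr0.
rewrite (memN_msupp_eq0 wp) mul0r big_seq big1 // => w' w'p.
rewrite mcoeffZ mcoeffX; case: eqP => [e|]; last by rewrite mulr0.
by rewrite e (negPf wp) in w'p.
Qed.

Lemma meval_rescale y p :
  meval y (rescale p) = meval (fun i => if i == ord0 then y i / q else y i) p.
Proof.
rewrite raddf_sum mevalE; apply: eq_bigr => w _ /=.
rewrite mevalZ mevalX -mulrA; congr (_ * _).
rewrite (bigD1 ord0) // [in RHS](bigD1 ord0) //= mulrA; congr (_ * _).
  by rewrite expr_div_n mulrC.
by apply: eq_bigr => i /negPf->.
Qed.

(* The operator p |-> (x_n - 1) p(x_n / q, x_1, ..., x_(n-1)). *)
Definition raise p : mpoly m.+1 C := (mvar ord_max - 1) * msym cyc (rescale p).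

Lemma meval_raise y p :
  meval y (raise p) = (y ord_max - 1)
    * meval (fun i => if i == ord0 then y ord_max / q else y (ord_pred i)) p.
Proof.
rewrite mevalM mevalB mevalXU meval1 meval_msym meval_rescale; congr (_ * _).
by apply: meval_eq => i /=; case: eqP => [->|]; rewrite ?cyc0 ?cycE.
Qed.

Lemma mcoeff_msym_rescale w p :
  mcoeff w (msym cyc (rescale p)) = mcoeff (mperm cyc w) p * q ^- w ord_max.
Proof. by rewrite mcoeff_sym mcoeff_rescale mnmE cyc0. Qed.

Lemma mcoeff_raise0 w p : w ord_max = 0%N ->
  mcoeff w (raise p) = - mcoeff (mperm cyc w) p.
Proof.
move=> w0; rewrite /raise mulrBl mul1r mcoeffB mcoeff_mvar_mul0 // sub0r.
by rewrite mcoeff_msym_rescale w0 expr0 invr1 mulr1.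
Qed.

Lemma mcoeff_mraise u p : (msize p <= (mdeg u).+1)%N ->
  mcoeff (mraise u) (raise p) = q ^- u ord0 * mcoeff u p.
Proof.
move/msize_leP => pu; rewrite /raise mulrBl mul1r mcoeffB [X in _ - X]mcoeff_msym_rescale.
(* The summand coming from -1 involves a coefficient of [p] in degree |u| + 1, beyond its size. *)
rewrite pu ?mul0r ?subr0; last by rewrite mdeg_mperm mdeg_mraise.
pose w : multinom m.+1 := Multinom [tuple u (ordS i) | i < m.+1].
have -> : mraise u = mnm_add (mnm1 ord_max) w.
  by apply/mnmP => i; rewrite mraiseE mnmDE mnm1E mnmE addnC eq_sym.
rewrite mcoeff_mvar_mul mcoeff_msym_rescale mulrC; congr (_ * _).
  by rewrite mnmE ordS_max.
congr mcoeff; apply/mnmP => i; by rewrite mpermE mnmE cycE ord_predK.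
Qed.

Lemma msize_raise p d : (msize p <= d)%N -> (msize (raise p) <= d.+1)%N.
Proof.
move=> pd; rewrite -[d.+1]add1n; apply: msizeM_le_add.
  by apply: msizeD_le_max; rewrite ?mmeasureN ?mmeasure1 ?msize_mvar.
apply: msize_msym; apply/msize_leP => w dw.
by move/msize_leP: pd => pd; rewrite mcoeff_rescale pd ?mul0r.
Qed.

End Raise.

(** * Interpolation polynomials *)

Section Spectral.
Context {C : numFieldType} (q t : C).
Hypotheses (q_neq0 : q != 0) (t_neq0 : t != 0).
Hypothesis (qt_generic : forall a b : nat, q ^+ a * t ^+ b = 1 -> a = 0%N /\ b = 0%N).

Lemma subr1_expM_neq0 a b : (0 < a + b)%N -> 1 - q ^+ a * t ^+ b != 0.
Proof.
move=> ab; apply/eqP => /eqP; rewrite subr_eq0 => /eqP/esym/qt_generic [a0 b0].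
by rewrite a0 b0 in ab.
Qed.

Section Vectors.
Context {n : nat}.
Implicit Types (u v w : multinom n) (i j k : 'I_n).

Lemma spectral_neq0 u i : spectral q t u i != 0.
Proof. by rewrite mulf_neq0 // expf_neq0. Qed.

Lemma spectral_inj u : injective (spectral q t u).
Proof.
suff H i j : below u j i -> spectral q t u i != spectral q t u j.
  move=> i j eij; apply/eqP/negPn/negP => /(below_total u).
  by case/orP => /H; rewrite eij eqxx.
move=> ji; have lt_k := spectral_exp_lt ji.
have le_u : (u j <= u i)%N by move: ji; rewrite /below; lia.
have -> : spectral q t u i = q ^+ (u i - u j)
    * t ^+ (spectral_exp u i - spectral_exp u j) * spectral q t u j.
  by rewrite /spectral mulrACA -!exprD !subnK // ltnW.
rewrite eq_sym -subr_eq0 -{1}[spectral q t u j]mul1r -mulrBl.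
rewrite mulf_neq0 ?spectral_neq0 // subr1_expM_neq0 //.
by rewrite addn_gt0 !subn_gt0 lt_k orbT.
Qed.

Lemma spectral_swap u i j k : j = i.+1 :> nat -> u i != u j ->
  spectral q t (mperm (tperm i j) u) k = spectral q t u (tperm i j k).
Proof. by move=> ij uij; rewrite /spectral mpermE spectral_exp_swap. Qed.

Lemma spectral_eqS u i j : j = i.+1 :> nat -> u i = u j ->
  spectral q t u i = t * spectral q t u j.
Proof.
by move=> ij uij; rewrite /spectral (spectral_exp_eqS ij uij) uij exprS mulrCA.
Qed.

(** Here the exchanged point is no spectral vector, but the factor x_i - t x_j vanishes. *)
Lemma meval_demazure_eq u i j p : j = i.+1 :> nat -> u i = u j ->
  meval (spectral q t u) (demazure t i j p) = 0.
Proof.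
move=> ij uij; rewrite mevalM mevalB mevalZ !mevalXU.
by rewrite (spectral_eqS ij uij) subrr mul0r.
Qed.

Lemma meval_demazure_neq u i j p : j = i.+1 :> nat -> u i != u j ->
  meval (spectral q t u) (demazure t i j p)
  = (spectral q t u i - t * spectral q t u j) / (spectral q t u i - spectral q t u j)
    * (meval (spectral q t u) p - meval (spectral q t (mperm (tperm i j) u)) p).
Proof.
move=> ij uij; rewrite meval_demazure; last first.
  rewrite (inj_eq (@spectral_inj u)); apply: contra_neq uij => -> //.
congr (_ * (_ - _)); apply: meval_eq => k /=.
by rewrite spectral_swap.
Qed.

(** The value at <u> of the normalised M_u; quotients of such values are also the top coefficients
    of the telescoped q-Pochhammer quotients. *)
Definition spectral_weight u : C :=
  \prod_(i < n) \prod_(j < u i) - (q ^+ j * t ^+ spectral_exp u i).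

Lemma spectral_weight_neq0 u : spectral_weight u != 0.
Proof.
apply/prodf_neq0 => i _; apply/prodf_neq0 => j _.
by rewrite oppr_eq0 mulf_neq0 // expf_neq0.
Qed.

Lemma spectral_weight_swap u i j : j = i.+1 :> nat -> u i != u j ->
  spectral_weight (mperm (tperm i j) u) = spectral_weight u.
Proof.
move=> ij uij; rewrite /spectral_weight [RHS](reindex_inj (@perm_inj _ (tperm i j))) /=.
by apply: eq_bigr => k _; rewrite mpermE spectral_exp_swap.
Qed.

Lemma c'_neq0 u : c' q t u != 0.
Proof.
apply/prodf_neq0 => i _; rewrite prodf_seq_neq0; apply/allP => j _ /=.
exact: subr1_expM_neq0.
Qed.

Definition norm_factor u : C := q ^+ nstat' u * t ^+ nstat u / c' q t u.

(** A linear condition: the degree is only bounded and no coefficient is normalised, so linear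
    combinations are allowed. *)
Definition interpolates u (p : mpoly n C) :=
  (msize p <= (mdeg u).+1)%N /\
  forall v, (mdeg v <= mdeg u)%N -> v != u -> meval (spectral q t v) p = 0.

(* What is left of the triangularity of the top homogeneous part: if [i] is the
   last nonzero position of [u], then no monomial of top degree is supported
   on the positions before [i]. *)
Definition top_supported u (p : mpoly n C) := forall w i,
  mdeg w = mdeg u -> u i != 0%N -> (forall k, (i <= k)%N -> w k = 0%N) -> mcoeff w p = 0.

End Vectors.

Section RaisedVectors.
Context {m : nat}.
Implicit Types (u v w : multinom m.+1) (p : mpoly m.+1 C).

Lemma spectral_mraise u i :
  spectral q t (mraise u) i = spectral q t u (ordS i) * (if i == ord_max then q else 1).
Proof.
rewrite /spectral spectral_exp_mraise mraiseE.
by case: eqP => _; rewrite ?addn1 ?addn0 ?mulr1 // exprSr mulrAC.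
Qed.

Lemma spectral_max0 u : u ord_max = 0%N -> spectral q t u ord_max = 1.
Proof. by move=> u0; rewrite /spectral spectral_exp_max0 // u0 mulr1. Qed.

Lemma meval_raise_max0 u p : u ord_max = 0%N -> meval (spectral q t u) (raise q p) = 0.
Proof. by move=> u0; rewrite meval_raise spectral_max0 // subrr mul0r. Qed.

Lemma meval_mraise u p : meval (spectral q t (mraise u)) (raise q p)
  = (q * spectral q t u ord0 - 1) * meval (spectral q t u) p.
Proof.
rewrite meval_raise spectral_mraise eqxx ordS_max; congr (_ * _); first by rewrite mulrC.
apply: meval_eq => i; case: eqP => [->|/eqP i0]; first by rewrite mulfK.
by rewrite spectral_mraise ord_predK -ordS_eq0 ord_predK (negPf i0) mulr1.
Qed.

Lemma spectral_weight_mraise u :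
  spectral_weight (mraise u) = - spectral q t u ord0 * spectral_weight u.
Proof.
rewrite /spectral_weight [in RHS](reindex_inj (@ordS_inj m.+1)) /=.
rewrite (bigD1 ord_max) //= [in RHS](bigD1 ord_max) //= mulrA; congr (_ * _).
  by rewrite mraiseE eqxx addn1 big_ord_recr /= spectral_exp_mraise ordS_max mulrC.
by apply: eq_bigr => i /negPf ne; rewrite mraiseE ne addn0 spectral_exp_mraise.
Qed.

Lemma c'_mraise u : c' q t (mraise u) = (1 - q * spectral q t u ord0) * c' q t u.
Proof.
rewrite /c' (prod_boxes_mraise _ (fun a l => 1 - q ^+ a.+1 * t ^+ l)) /=.
by rewrite exprS -mulrA.
Qed.

Lemma c'_swap u (i j : 'I_m.+1) (u' := mperm (tperm i j) u) (l := leg u' i 1) :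
    j = i.+1 :> nat -> u i = 0%N -> (0 < u j)%N ->
    (forall k : 'I_m.+1, (j < k)%N -> u k = 0%N) ->
  (1 - q ^+ u j * t ^+ l.+1) * c' q t u' = (1 - q ^+ u j * t ^+ l) * c' q t u.
Proof.
move=> ij ui0 uj0 utail.
rewrite -(prednK uj0).
exact: (prod_boxes_swap ij ui0 uj0 utail _ (fun a l => 1 - q ^+ a.+1 * t ^+ l)).
Qed.

(** The invariant of the recursive construction: top support keeps the leading coefficient under
    control in the swap step, and the evaluation is carried along with it. *)
Definition interp_ex u := exists p : mpoly m.+1 C,
  [/\ interpolates u p, top_supported u p, mcoeff u p = q ^- nstat' u
    & norm_factor u * meval (spectral q t u) p = spectral_weight u].

Lemma interp_ex0 : interp_ex mnm0.
Proof.
exists 1; split.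
- split=> [|v]; first by rewrite mmeasure1 mdeg0.
  by rewrite mdeg0 leqn0 mdeg_eq0 => ->.
- by move=> w i _; rewrite mnm0E.
- by rewrite mcoeff1 eqxx /nstat' big1 ?expr0 ?invr1 // => i _; rewrite mnm0E.
have -> : spectral_weight (mnm0 : multinom m.+1) = 1.
  by rewrite /spectral_weight big1 // => i _; rewrite mnm0E big_ord0.
rewrite meval1 mulr1 /norm_factor.
have -> : c' q t (mnm0 : multinom m.+1) = 1 by rewrite /c' big1 // => i _; rewrite mnm0E big_geq.
have -> : nstat' (mnm0 : multinom m.+1) = 0%N by rewrite /nstat' big1 // => i _; rewrite mnm0E.
have -> : nstat (mnm0 : multinom m.+1) = 0%N.
  by rewrite /nstat big1 // => i _; rewrite mnm0E big_geq.
by rewrite !expr0 mulr1 divr1.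
Qed.

(** The factor x_n - 1 kills the points with last entry 0, and every other point is raised from a
    point where [p] is known. At [mraise u] this factor is, up to sign, the factor of the new box in
    [c']; what remains is -<u>_1, the new factor of [spectral_weight]. *)
Lemma interp_ex_mraise u : interp_ex u -> interp_ex (mraise u).
Proof.
move=> [p [[pd pv] _ pu pE]]; exists (raise q p); split.
- split=> [|v]; first by rewrite mdeg_mraise msize_raise.
  have [v0|v0] := eqVneq (v ord_max) 0%N; first by rewrite meval_raise_max0.
  rewrite -[v]mlowerK // !mdeg_mraise ltnS => vd vu.
  by rewrite meval_mraise pv ?mulr0 //; apply: contra_neq vu => ->.
- move=> w i ew _ wk; have w0 : w ord_max = 0%N by apply/wk/leq_ord.
  rewrite mcoeff_raise0 //; move/msize_leP: pd => ->; rewrite ?oppr0 //.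
  by rewrite mdeg_mperm ew mdeg_mraise.
- by rewrite mcoeff_mraise // pu nstat'_mraise exprD invfM mulrC.
rewrite meval_mraise spectral_weight_mraise -pE /norm_factor c'_mraise.
rewrite nstat_mraise nstat'_mraise (exprD q) (exprD t (nstat u)) /spectral.
have := @subr1_expM_neq0 (u ord0).+1 (spectral_exp u ord0) isT.
rewrite exprS -mulrA => nz; have := c'_neq0 u => nz'.
move: nz nz'; move: (q ^+ u ord0) (t ^+ spectral_exp u ord0) (q ^+ nstat' u) => a b d.
move: (t ^+ nstat u) (c' q t u) (meval _ p) => e c k nz nz'.
by field; rewrite nz nz'.
Qed.

(** [demazure] applied to [p] can be nonzero only at u and u' among the points of degree at most
    |u|; a multiple of [p] corrects the value at u, and the sign makes the coefficient of x^u' equal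
    to that of x^u in [p]. *)
Lemma interp_ex_swap u (i j : 'I_m.+1) : j = i.+1 :> nat -> u i = 0%N -> (0 < u j)%N ->
    (forall k : 'I_m.+1, (j < k)%N -> u k = 0%N) ->
  interp_ex u -> interp_ex (mperm (tperm i j) u).
Proof.
move=> ij ui0 uj0 utail [p [[pd pv] ps pu pE]].
have neq_ij : i != j by rewrite -val_eqE /= ij; lia.
set u' := mperm _ u.
have u'i : u' i = u j by rewrite mpermE tpermL.
have u'j : u' j = 0%N by rewrite mpermE tpermR.
have uij : u i != u j by rewrite ui0; lia.
have u'u : u' != u by apply: contraTneq uj0 => <-; rewrite u'j.
pose x := spectral q t u i; pose y := spectral q t u j.
have xy : x != y by rewrite (inj_eq (@spectral_inj _ u)).
(* The scalar for which [demazure t i j p + c *: p] vanishes at <u>, where p(<u'>) = 0. *)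
pose c := - ((x - t * y) / (x - y)).
(* The composition u' lives on the positions before [j], the last nonzero position of u, so top
   support applies. *)
have pu'0 : mcoeff u' p = 0.
  apply: (ps _ j); rewrite ?mdeg_mperm -?lt0n // => k jk.
  rewrite mpermE; case: tpermP => [e|//|ki kj]; first by move: jk; rewrite e ij; lia.
  by apply: utail; rewrite ltn_neqAle jk andbT; apply: contra_not_neq kj => /val_inj.
exists (- (demazure t i j p + c *: p)); split.
- split=> [|v].
    by rewrite mdeg_mperm mmeasureN msizeD_le_max ?msize_demazure ?msizeZ_le_trans.
  rewrite mdeg_mperm => vd vu'; rewrite mevalN mevalD mevalZ.
  have [->|vu] := eqVneq v u.
    rewrite meval_demazure_neq // -/u' (pv u') ?mdeg_mperm //.
    by rewrite subr0 -mulrDl -/x -/y /c subrr mul0r oppr0.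
  rewrite pv // mulr0 addr0.
  have [vij|vij] := eqVneq (v i) (v j); first by rewrite meval_demazure_eq ?oppr0.
  rewrite meval_demazure_neq // !pv ?mdeg_mperm ?subrr ?mulr0 ?oppr0 //.
  by apply: contra_neq vu' => vu'; rewrite /u' -vu' mperm_tpermK.
- move=> w k; rewrite mdeg_mperm => ew u'k wk.
  have ki : (k <= i)%N.
    rewrite leqNgt; apply/negP => ik; move: u'k; rewrite mpermE.
    case: tpermP => [e|e|]; [by rewrite e ltnn in ik | by rewrite ui0 | move=> /eqP ki /eqP kj].
    rewrite utail //; move: ki kj; rewrite -!val_eqE /=; lia.
  have wi : w i = 0%N by apply: wk.
  have wj : w j = 0%N by apply: wk; rewrite ij; lia.
  have sw : mperm (tperm i j) w = w.
    by apply/mnmP => l; rewrite mpermE; case: tpermP => // ->; rewrite wi wj.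
  rewrite mcoeffN mcoeffD mcoeffZ mcoeff_demazure_r // sw subrr add0r.
  rewrite (ps w j) ?mulr0 ?oppr0 -?lt0n // => l jl.
  by apply: wk; apply: leq_trans ki _; apply: leq_trans jl; rewrite ij.
- rewrite mcoeffN mcoeffD mcoeffZ pu'0 mulr0 addr0 mcoeff_demazure_r // pu'0.
  by rewrite mperm_tpermK sub0r opprK pu nstat'_swap.
have u'ij : u' i != u' j by rewrite u'i u'j -lt0n.
rewrite mevalN mevalD mevalZ (pv u') ?mdeg_mperm // mulr0 addr0.
rewrite meval_demazure_neq // mperm_tpermK (pv u') ?mdeg_mperm // sub0r [X in - X]mulrN opprK.
rewrite !spectral_swap // tpermL tpermR spectral_weight_swap // -pE.
have c'E := c'_swap ij ui0 uj0 utail.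
rewrite /norm_factor (nstat_swap ij ui0 uj0 utail) nstat'_swap exprS.
have := spectral_neq0 u i; have -> : spectral q t u j
    = q ^+ u j * t ^+ (leg u' i 1).+1 * spectral q t u i.
  rewrite /spectral ui0 mul1r (spectral_exp_swap_leg ij ui0 uj0 utail) (exprD t (leg u j 1)) mulrA.
  by rewrite (leg_swap ij ui0 uj0 utail) ?addn1.
have nz1 := @subr1_expM_neq0 (u j) (leg u' i 1) (ltn_addr _ uj0).
have nz2 := @subr1_expM_neq0 (u j) (leg u' i 1).+1 (ltn_addr _ uj0).
have := c'_neq0 u'; have -> : c' q t u = (1 - q ^+ u j * t ^+ (leg u' i 1).+1) * c' q t u'
    / (1 - q ^+ u j * t ^+ leg u' i 1).
  by rewrite c'E mulrAC mulfV // mul1r.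
move: nz1 nz2; rewrite -/u' exprS.
move: (q ^+ u j) (t ^+ leg u' i 1) (spectral q t u i) (c' q t u') => a b s d.
move: (q ^+ nstat' u) (t ^+ nstat u') (meval _ p) => e f k nz1 nz2 nzd nzs.
field; rewrite nzd nz1 nz2 /= -{2}[s]mul1r -mulrBl mulf_neq0 //.
by rewrite -opprB oppr_eq0.
Qed.

Lemma interp_exists u : interp_ex u.
Proof.
elim/mnm_raise_swap_ind: u => [|u|u i j].
- exact: interp_ex0.
- exact: interp_ex_mraise.
- exact: interp_ex_swap.
Qed.

(** * Polynomials of bounded degree are determined by their values at spectral points *)

Section Unisolvence.
Variable d : nat.
Let N := #|{: bmultinom m.+1 d}|.
Let mono (a : 'I_N) : multinom m.+1 := bmnm (enum_val a).

Let mono_deg a : (mdeg (mono a) < d)%N.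
Proof. exact: bmdeg. Qed.

Let mono_eq a b : (mono a == mono b) = (a == b).
Proof. by rewrite /mono -bmeqP (inj_eq enum_val_inj). Qed.

Let mono_onto w : (mdeg w < d)%N -> exists a, mono a = w.
Proof.
by move=> wd; exists (enum_rank (BMultinom wd)); rewrite /mono enum_rankK.
Qed.

Let evalmx : 'M[C]_N := \matrix_(a, b) meval (spectral q t (mono b)) (mpolyX C (mono a)).
Let coefs p : 'rV[C]_N := \row_a mcoeff (mono a) p.

Let coefs_eval p b : (msize p <= d)%N ->
  (coefs p *m evalmx) 0 b = meval (spectral q t (mono b)) p.
Proof.
move=> pd; rewrite mxE [in RHS](mpolywE pd) raddf_sum /=.
rewrite [RHS](reindex (enum_val (A := {: bmultinom m.+1 d}))) /=; last first.
  by exists enum_rank => a _; rewrite ?enum_valK ?enum_rankK.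
by apply: eq_bigr => a _; rewrite !mxE mevalZ.
Qed.

(** Descending induction on the degree of [mono b]: the values of its interpolation polynomial form
    a nonzero multiple of the unit row at [b] plus unit rows at points of larger degree, already
    obtained. *)
Let delta_sub b : ((delta_mx 0 b : 'rV[C]_N) <= evalmx)%MS.
Proof.
have [c] := ubnP (d - mdeg (mono b)); elim: c b => // c IHc b; rewrite ltnS => dc.
have [p [[pd pv] _ _ pE]] := interp_exists (mono b).
have pd' : (msize p <= d)%N by apply: leq_trans pd (mono_deg b).
set k := meval _ p in pE; have k0 : k != 0.
  apply: contraTneq (spectral_weight_neq0 (mono b)) => k0.
  by rewrite -pE k0 mulr0 eqxx.
rewrite -(eqmx_scale _ k0) -[_ *: _](addrNK (coefs p *m evalmx)) addmx_sub ?submxMl //.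
rewrite [X in _ - X]row_sum_delta (bigD1 b) //= coefs_eval // -/k opprD addNKr.
rewrite eqmx_opp summx_sub // => a ab; rewrite coefs_eval //.
have [le_ab|lt_ba] := leqP (mdeg (mono a)) (mdeg (mono b)).
  by rewrite pv ?mono_eq // scale0r sub0mx.
by rewrite scalemx_sub // IHc //; apply: leq_trans dc; have := mono_deg a; lia.
Qed.

Lemma unisolvent p : (msize p <= d)%N ->
  (forall w, (mdeg w < d)%N -> meval (spectral q t w) p = 0) -> p = 0.
Proof.
move=> pd p0; have evU : evalmx \in unitmx.
  rewrite -row_full_unit -sub1mx; apply/row_subP => a.
  by rewrite row1 delta_sub.
have : coefs p *m evalmx = 0.
  by apply/rowP => b; rewrite coefs_eval // mxE p0 // mono_deg.
move/(congr1 (mulmx^~ (invmx evalmx))); rewrite mulmxK // mul0mx => cp.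
apply/mpolyP => w; rewrite mcoeff0; have [wd|dw] := ltnP (mdeg w) d.
  have [a <-] := mono_onto wd.
  by have := congr1 (fun M : 'rV_N => M 0 a) cp; rewrite !mxE.
by move/msize_leP: pd => ->.
Qed.

End Unisolvence.

Lemma interpolates_eq0 u p :
  interpolates u p -> meval (spectral q t u) p = 0 -> p = 0.
Proof.
move=> [pd pv] pu; apply: (unisolvent pd) => w wd.
by have [->|wu] := eqVneq w u; [exact: pu | exact: pv].
Qed.

Lemma interpolates_unique u p p' : interpolates u p -> interpolates u p' ->
  mcoeff u p != 0 -> mcoeff u p = mcoeff u p' -> p = p'.
Proof.
move=> ip ip' cu ecu.
pose a := meval (spectral q t u) p; pose b := meval (spectral q t u) p'.
have a0 : a != 0.
  by apply: contra_neq cu => /(interpolates_eq0 ip) ->; rewrite mcoeff0.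
(* Cross-multiplying by the values at <u> makes the combination vanish there as well; comparing
   coefficients of x^u then yields a = b. *)
have e : b *: p - a *: p' = 0.
  apply: (@interpolates_eq0 u); last by rewrite mevalB !mevalZ mulrC subrr.
  case: ip ip' => [pd pv] [pd' pv']; split=> [|v vd vu].
    by apply: msizeD_le_max; rewrite ?mmeasureN msizeZ_le_trans.
  by rewrite mevalB !mevalZ pv ?pv' // !mulr0 subrr.
have /eqP := congr1 (mcoeff u) e.
rewrite mcoeffB !mcoeffZ mcoeff0 -ecu -mulrBl mulf_eq0 (negPf cu) orbF subr_eq0.
move/eqP => eba; move/eqP: e; rewrite eba -scalerBr mscalerI (negPf a0) subr_eq0.
by move/eqP.
Qed.

Lemma norm_interp_macdonaldP u (p := norm_interp_macdonald q t u) :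
  interpolates u p /\ meval (spectral q t u) p = spectral_weight u.
Proof.
have [p' [ip' _ cp' pE']] := interp_exists u.
have q_pow0 : q ^- nstat' u != 0 by rewrite invr_eq0 expf_neq0.
have M_ex : is_interp_macdonald q t u p'.
  case: ip' => pd' pv'; split=> //; apply/eqP; rewrite eqn_leq pd'.
  by rewrite msize_gt_mdeg // cp'.
rewrite /p /norm_interp_macdonald -/(norm_factor u).
have -> : interp_macdonald q t u = p'.
  have [Md Mv Mc] : is_interp_macdonald q t u (interp_macdonald q t u).
    by rewrite /interp_macdonald; case: xgetP => [P -> //|/(_ p')].
  apply: (@interpolates_unique u); rewrite ?Mc ?cp' //.
  by split=> //; rewrite Md.
rewrite mevalZ pE'; split=> //; case: ip' => pd' pv'; split=> [|v vd vu].
  exact: msizeZ_le_trans.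
by rewrite mevalZ pv' ?mulr0.
Qed.

(** If u and w differ and |w| <= |u|, then M_u vanishes at <w> but not at <u>. *)
Lemma spectral_inj_mnm u w : spectral q t u =1 spectral q t w -> u = w.
Proof.
wlog le_wu : u w / (mdeg w <= mdeg u)%N.
  move=> H e; case/orP: (leq_total (mdeg w) (mdeg u)) => ?; first exact: H.
  by symmetry; apply: H => // i; rewrite e.
move=> e; have [[_ pv] pE] := norm_interp_macdonaldP u.
apply: contraNeq (spectral_weight_neq0 u) => wu; rewrite -pE (meval_eq _ e).
by rewrite pv // eq_sym.
Qed.

End RaisedVectors.
End Spectral.

(** * Extra vanishing *)

Section Eigenoperators.
Context {C : numFieldType} (q t : C).
Hypotheses (q_neq0 : q != 0) (t_neq0 : t != 0).
Hypothesis (qt_generic : forall a b : nat, q ^+ a * t ^+ b = 1 -> a = 0%N /\ b = 0%N).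
Context {m : nat}.
Implicit Types (u v w : multinom m.+1) (p : mpoly m.+1 C) (f : nat -> nat).

(** For distinct [i] and [j] this is a Hecke algebra generator T with (T - t)(T + 1) = 0. *)
Definition hecke i j p : mpoly m.+1 C := t *: p - demazure t i j p.

(** The product T_l T_(l+1) ... T_(l+k-1), with positions counted from 0 and l + k <= m in every
    use. *)
Fixpoint hecke_chain (l k : nat) p : mpoly m.+1 C :=
  if k is k'.+1 then hecke (inord l) (inord l.+1) (hecke_chain l.+1 k' p) else p.

(* Multiplying the Cherednik operator of index [i] by [x_i] and removing its
   scalar term leaves this composite, which involves no division by [x_i]. *)
Definition cherednik (i : nat) p : mpoly m.+1 C :=
  hecke_chain i (m - i) (raise q (hecke_chain 0 i p)).

Lemma inordS l : (l < m)%N -> (inord l.+1 : 'I_m.+1) = (inord l : 'I_m.+1).+1 :> nat.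
Proof. by move=> lm; rewrite !inordK // ltnW. Qed.

Lemma inord_neq l : (l < m)%N -> inord l != inord l.+1 :> 'I_m.+1.
Proof. by move=> lm; rewrite -val_eqE /= inordS //; lia. Qed.

Lemma msize_hecke_chain l k p d : (l + k <= m)%N ->
  (msize p <= d)%N -> (msize (hecke_chain l k p) <= d)%N.
Proof.
elim: k l => //= k IHk l lk pd.
have {}IHk : (msize (hecke_chain l.+1 k p) <= d)%N by apply: IHk; rewrite ?addSnnS.
rewrite msizeD_le_max ?msizeZ_le_trans // mmeasureN msize_demazure //.
by rewrite inord_neq //; lia.
Qed.

Lemma msize_cherednik (i : 'I_m.+1) p d : (msize p <= d)%N -> (msize (cherednik i p) <= d.+1)%N.
Proof.
move=> pd; apply: msize_hecke_chain; first by have := leq_ord i; lia.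
by apply: msize_raise; apply: msize_hecke_chain; rewrite // leq_ord.
Qed.

(** At <w>, a factor [hecke] reads its argument at <w> and at the point with two entries of w
    exchanged; if these entries are equal, the [demazure] term vanishes. Hence zeros on a
    permutation-stable set persist. *)
Lemma meval_hecke_chain0 (Z : multinom m.+1 -> Prop) l k p :
    (forall s w, Z w -> Z (mperm s w)) -> (l + k <= m)%N ->
    (forall w, Z w -> meval (spectral q t w) p = 0) ->
  forall w, Z w -> meval (spectral q t w) (hecke_chain l k p) = 0.
Proof.
move=> Zs; elim: k l => //= k IHk l lk pZ w Zw.
have {}IHk : forall w, Z w -> meval (spectral q t w) (hecke_chain l.+1 k p) = 0.
  by apply: IHk; rewrite ?addSnnS.
have lm : (l < m)%N by lia.
rewrite mevalB mevalZ IHk // mulr0 sub0r.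
have [e|ne] := eqVneq (w (inord l)) (w (inord l.+1)).
  by rewrite meval_demazure_eq ?oppr0 // inordS.
by rewrite meval_demazure_neq ?inordS // !IHk ?subrr ?mulr0 ?oppr0 //; apply: Zs.
Qed.

(** The Hecke factors only permute w, and [raise] either vanishes or reads [p] at a lowered
    composition. So the value at <w> depends only on values of [p] at compositions of smaller degree
    dominated by w. *)
Lemma meval_cherednik0 (i : 'I_m.+1) p w :
    (forall w', mnm_dom w' w -> (mdeg w' < mdeg w)%N -> meval (spectral q t w') p = 0) ->
  meval (spectral q t w) (cherednik i p) = 0.
Proof.
move=> pw; pose Z w' := mnm_dom w' w /\ mdeg w' = mdeg w.
apply: (@meval_hecke_chain0 Z) => //; last by split; first exact: mnm_dom_refl.
- by move=> s w' [dw' ew']; split; rewrite ?mdeg_mperm // mnm_dom_mperm.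
- by have := leq_ord i; lia.
move=> w1 [dw1 ew1].
have [w10|w10] := eqVneq (w1 ord_max) 0%N; first exact: meval_raise_max0.
rewrite -(mlowerK w10) meval_mraise //.
pose Z' w' := mnm_dom w' w /\ (mdeg w' < mdeg w)%N.
rewrite (@meval_hecke_chain0 Z') ?mulr0 ?leq_ord //.
- by move=> s w' [dw' ew']; split; rewrite ?mdeg_mperm // mnm_dom_mperm.
- by move=> w' [d1 d2]; apply: pw.
split; first exact: mnm_dom_trans (mlower_dom w1) dw1.
by rewrite -ew1 -[in ltnRHS](mlowerK w10) mdeg_mraise.
Qed.

(** Exponents of a monomial free of x_i, arranged so that the zero can be moved: in [cherednik] it
    travels from position i to the end, jumps to the front and returns to i. *)
Definition insert0 (i : nat) f : multinom m.+1 :=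
  Multinom [tuple if (a < i)%N then f a else if a == i :> nat then 0%N else f a.-1 | a < m.+1].

Lemma insert0E i f (a : 'I_m.+1) : insert0 i f a
  = (if (a < i)%N then f a else if a == i :> nat then 0%N else f a.-1).
Proof. exact: mnmE. Qed.

Lemma insert0_swap l f : (l < m)%N ->
  mperm (tperm (inord l) (inord l.+1)) (insert0 l f) = insert0 l.+1 f.
Proof.
move=> lm; have el : (inord l : 'I_m.+1) = l :> nat by rewrite inordK // ltnW.
have eS : (inord l.+1 : 'I_m.+1) = l.+1 :> nat by rewrite inordK.
apply/mnmP => a; rewrite mpermE !insert0E; case: tpermP => [->|->|/eqP + /eqP +].
- by rewrite el eS ltnSn ltnNge leqnSn gtn_eqF.
- by rewrite el eS !ltnn !eqxx.
rewrite -!val_eqE /= el eS => a1 a2.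
by case: (ltngtP a l) => al; rewrite ?ltnS; [ | | rewrite al eqxx in a1];
   (do ?case: ifP => //); lia.
Qed.

Lemma insert0_cyc f : mperm cyc (insert0 m f) = insert0 0 f.
Proof.
apply/mnmP => a; rewrite mpermE !insert0E cycE ltn0.
have [->|a0] := eqVneq a ord0.
  have -> : ord_pred (ord0 : 'I_m.+1) = ord_max by rewrite -cycE cyc0.
  by rewrite ltnn eqxx.
have e : ord_pred a = a.-1 :> nat.
  by apply: succn_inj; rewrite -[in RHS](ord_predK a) ordS_val -ordS_eq0 ord_predK (negPf a0).
have := ltn_ord a; move: a0; rewrite -val_eqE e /= => a0 am.
by rewrite (negPf a0) [X in if X then _ else _]((_ : _ = true)) //; lia.
Qed.

Lemma insert0_ex (i : 'I_m.+1) w : w i = 0%N -> exists f, w = insert0 i f.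
Proof.
move=> wi; exists (fun a => w (inord (if (a < i)%N then a else a.+1))).
apply/mnmP => a; rewrite insert0E; case: ltngtP => ai; first by rewrite inord_val.
  have -> : (a.-1 < i)%N = false by lia.
  by rewrite prednK ?inord_val //; lia.
by rewrite (val_inj ai : a = i).
Qed.

(** By [mcoeff_demazure_l], each T_l sends the coefficient at a monomial free of x_l to t times the
    coefficient at the exchanged monomial. *)
Lemma mcoeff_hecke_chain l k f p : (l + k <= m)%N ->
  mcoeff (insert0 l f) (hecke_chain l k p) = t ^+ k * mcoeff (insert0 (l + k) f) p.
Proof.
elim: k l => [|k IHk] l lk /=; first by rewrite addn0 mul1r.
have lm : (l < m)%N by lia.
rewrite mcoeffB mcoeffZ mcoeff_demazure_l; last first.
  by rewrite insert0E inordK ?ltnn ?eqxx // ltnW.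
by rewrite insert0_swap // mulrBr subKr IHk ?addSnnS // exprS mulrA.
Qed.

(** This makes [cherednik i p + t ^+ m *: p] divisible by x_i. *)
Lemma mcoeff_cherednik (i : 'I_m.+1) p w : w i = 0%N ->
  mcoeff w (cherednik i p) = - (t ^+ m * mcoeff w p).
Proof.
case/insert0_ex => f ->; have im := leq_ord i.
rewrite mcoeff_hecke_chain subnKC // mcoeff_raise0; last by rewrite insert0E ltnn eqxx.
by rewrite insert0_cyc mcoeff_hecke_chain // add0n mulrN mulrA -exprD subnK.
Qed.

(** The left side is x_i g with g of degree at most |u|. At <w> with |w| <= |u|, the operator sees
    only points of smaller degree, where [p] vanishes, so <w>_i g(<w>) = t^m p(<w>). Thus g agrees
    with a multiple of [p] at all these points, and unisolvence concludes. *)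
Lemma cherednik_eigen u p (i : 'I_m.+1) : interpolates q t u p ->
  cherednik i p + t ^+ m *: p = (t ^+ m / spectral q t u i) *: (mvar i * p).
Proof.
move=> [pd pv]; have [|g eg] := @mvar_div _ _ i (cherednik i p + t ^+ m *: p).
  by move=> w wi; rewrite mcoeffD mcoeffZ mcoeff_cherednik // addNr.
suff -> : cherednik i p + t ^+ m *: p = mvar i * ((t ^+ m / spectral q t u i) *: p).
  by rewrite -scalerAr.
rewrite eg; congr (_ * _); apply/eqP; rewrite -subr_eq0; apply/eqP.
have gd : (msize g <= (mdeg u).+1)%N.
  have [->|g0] := eqVneq g 0; first by rewrite mmeasure0.
  have X0 : mvar i != 0 :> mpoly m.+1 C 
    by apply/eqP => X0; have := @msize_mvar C _ i; rewrite X0 mmeasure0.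
  have := msizeM X0 g0; rewrite -eg msize_mvar add2n /= => eg1.
  rewrite -ltnS -eg1 msizeD_le_max ?msize_cherednik ?msizeZ_le_trans //.
  exact: leqW.
apply: (@unisolvent _ _ _ q_neq0 t_neq0 qt_generic _ (mdeg u).+1) => [|w].
  by rewrite msizeD_le_max // mmeasureN msizeZ_le_trans.
rewrite ltnS => wd; have := congr1 (meval (spectral q t w)) eg.
rewrite mevalD mevalM mevalXU mevalZ meval_cherednik0 ?add0r; last first.
  move=> w' _ w'w; rewrite pv //; first by apply: ltnW; apply: leq_trans wd.
  by apply: contraTneq w'w => ->; rewrite -leqNgt.
rewrite mevalB mevalZ => e; apply: (mulfI (spectral_neq0 q_neq0 t_neq0 w i)).
rewrite mulr0 mulrBr -e; have [->|wu] := eqVneq w u; last by rewrite pv // !mulr0 subrr.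
by rewrite mulrA mulrCA mulfV ?mulr1 ?subrr // spectral_neq0.
Qed.

(** If w does not dominate u, neither does any composition dominated by w, so by induction the
    operator contributes nothing at <w>. For a position [i] where <u> and <w> differ, the eigenvalue
    equation then forces p(<w>) = 0. *)
Lemma extra_vanishing u p w : interpolates q t u p ->
  meval (spectral q t w) p != 0 -> mnm_dom u w.
Proof.
move=> ip; have [d] := ubnP (mdeg w); elim: d w => // d IHd w; rewrite ltnS => wd pw.
have [->|uw] := eqVneq u w; first exact: mnm_dom_refl.
have [i ne] : exists i, spectral q t u i != spectral q t w i.
  apply/existsP; apply: contraNT uw; rewrite negb_exists => /forallP e.
  apply/eqP; apply: (spectral_inj_mnm q_neq0 t_neq0 qt_generic) => i.
  by apply/eqP; rewrite -[_ == _]negbK e.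
apply: contrapT => Ndom.
have := congr1 (meval (spectral q t w)) (cherednik_eigen i ip).
rewrite mevalD !mevalZ mevalM mevalXU meval_cherednik0 ?add0r.
  move/eqP; rewrite mulrA -subr_eq0 -mulrBl mulf_eq0 (negPf pw) orbF.
  rewrite -mulrA -{1}[t ^+ m]mulr1 -mulrBr mulf_eq0 expf_eq0 (negPf t_neq0) andbF /=.
  rewrite subr_eq0 => /eqP e; move/negP: ne; apply.
  have u0 := spectral_neq0 q_neq0 t_neq0 u i.
  by rewrite -(mulVKf u0 (spectral q t w i)) -e mulr1.
move=> w' dw' lt_w'; apply/eqP; rewrite -[_ == _]negbK; apply/negP => pw'.
apply: Ndom; apply: mnm_dom_trans dw'; apply: IHd => //.
exact: leq_trans lt_w' wd.
Qed.

End Eigenoperators.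

(** * Formal power series and q-Pochhammer symbols *)

Section FormalPowerSeries.
Context {C : fieldType}.
Implicit Types (f g h : fps C) (p : {poly C}).

Definition fps_of_poly p : fps C := fun k => p`_k.

Definition fps_scale (x : C) f : fps C := fun k => x ^+ k * f k.

(** Low coefficients see only truncations, so the laws of series multiplication follow from those of
    polynomials. *)
Lemma fps_mul_poly K f g k : (k < K)%N ->
  fps_mul f g k = (\poly_(i < K) f i * \poly_(i < K) g i)`_k.
Proof.
move=> kK; rewrite coefM; apply: eq_bigr => i _; rewrite !coef_poly.
by rewrite (leq_ltn_trans (leq_ord i) kK) (leq_ltn_trans (leq_subr i k) kK).
Qed.

Lemma fps_mulC : commutative (@fps_mul C).
Proof. by move=> f g; apply/funext => k; rewrite !(fps_mul_poly _ _ (ltnSn k)) mulrC. Qed.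

Lemma fps_mulA : associative (@fps_mul C).
Proof.
have E f g h k : fps_mul (fps_mul f g) h k
  = (\poly_(i < k.+1) f i * \poly_(i < k.+1) g i * \poly_(i < k.+1) h i)`_k.
  rewrite coefM; apply: eq_bigr => i _; rewrite -(fps_mul_poly _ _ (ltn_ord i)).
  by rewrite coef_poly ltnS leq_subr.
move=> f g h; apply/funext => k.
by rewrite fps_mulC !E; congr (_ `_ k); rewrite mulrC mulrA.
Qed.

Lemma fps_mul1 : left_id (@fps_one C) (@fps_mul C).
Proof.
move=> f; apply/funext => k; rewrite /fps_mul big_ord_recl subn0 mul1r.
by rewrite big1 ?addr0 // => i _; rewrite /fps_one mul0r.
Qed.

Lemma fps_mulr1 : right_id (@fps_one C) (@fps_mul C).
Proof. by move=> f; rewrite fps_mulC fps_mul1. Qed.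

HB.instance Definition _ :=
  Monoid.isComLaw.Build (fps C) fps_one (@fps_mul C) fps_mulA fps_mulC fps_mul1.

Lemma fps_mulACA : interchange (@fps_mul C) (@fps_mul C).
Proof. exact: Monoid.mulmACA. Qed.

Lemma fps_mulV f : f 0%N != 0 -> fps_mul f (fps_inv f) = fps_one.
Proof. by move=> f0; rewrite fps_mulC; apply/funext/fps_mulVf. Qed.

Lemma fps_inv_unique f g : f 0%N != 0 -> fps_mul f g = fps_one -> fps_inv f = g.
Proof.
move=> f0 fg; rewrite -[LHS]fps_mulr1 -fg fps_mulA.
by rewrite (fps_mulC _ f) fps_mulV // fps_mul1.
Qed.

Lemma fps_mul_coef0 f g : fps_mul f g 0%N = f 0%N * g 0%N.
Proof. by rewrite /fps_mul big_ord1. Qed.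

Lemma fps_inv1 : fps_inv fps_one = fps_one :> fps C.
Proof. by apply: fps_inv_unique; rewrite ?fps_mul1 // oner_neq0. Qed.

Lemma fps_inv_mul f g : f 0%N != 0 -> g 0%N != 0 ->
  fps_inv (fps_mul f g) = fps_mul (fps_inv f) (fps_inv g).
Proof.
move=> f0 g0; apply: fps_inv_unique; first by rewrite fps_mul_coef0 mulf_neq0.
by rewrite fps_mulACA !fps_mulV // fps_mul1.
Qed.

Lemma fps_inv_prod (I : finType) (F : I -> fps C) : (forall i, F i 0%N != 0) ->
  fps_inv (\big[fps_mul/fps_one]_i F i) = \big[fps_mul/fps_one]_i fps_inv (F i).
Proof.
move=> F0; suff [-> //] : fps_inv (\big[fps_mul/fps_one]_i F i)
    = \big[fps_mul/fps_one]_i fps_inv (F i) /\ (\big[fps_mul/fps_one]_i F i) 0%N != 0.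
apply: (big_ind2 (fun f g => fps_inv f = g /\ f 0%N != 0)) => //.
  by split; [exact: fps_inv1 | exact: oner_neq0].
by move=> f f' g g' [<- f0] [<- g0]; rewrite fps_inv_mul // fps_mul_coef0 mulf_neq0.
Qed.

Lemma fps_scale_mul x f g :
  fps_mul (fps_scale x f) (fps_scale x g) = fps_scale x (fps_mul f g).
Proof.
apply/funext => k; rewrite /fps_mul /fps_scale mulr_sumr; apply: eq_bigr => i _.
by rewrite mulrACA -exprD subnKC // leq_ord.
Qed.

Lemma fps_inv_scale x f : f 0%N != 0 -> fps_inv (fps_scale x f) = fps_scale x (fps_inv f).
Proof.
move=> f0; apply: fps_inv_unique; first by rewrite /fps_scale mul1r.
rewrite fps_scale_mul fps_mulV //; apply/funext => k.
by rewrite /fps_scale /fps_one; case: k => [|k]; rewrite ?mul1r ?mulr0.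
Qed.

Lemma fps_of_poly1 : fps_of_poly 1 = fps_one.
Proof. by apply/funext => k; rewrite /fps_of_poly coef1. Qed.

Lemma fps_of_polyM p1 p2 :
  fps_of_poly (p1 * p2) = fps_mul (fps_of_poly p1) (fps_of_poly p2).
Proof. by apply/funext => k; rewrite /fps_of_poly coefM. Qed.

Lemma fps_of_poly_prod (I : finType) (F : I -> {poly C}) :
  fps_of_poly (\prod_i F i) = \big[fps_mul/fps_one]_i fps_of_poly (F i).
Proof. exact: (big_morph _ fps_of_polyM fps_of_poly1). Qed.

Lemma fps_monomial_mul c d f k :
  fps_mul (fps_monomial c d) f k = if (d <= k)%N then c * f (k - d)%N else 0.
Proof.
rewrite /fps_mul /fps_monomial; case: leqP => [dk|kd].
  rewrite (bigD1 (Ordinal (dk : d < k.+1)%N)) //= eqxx big1 ?addr0 // => i.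
  by rewrite -val_eqE /= => /negPf->; rewrite mul0r.
rewrite big1 // => i _; case: eqP => [e|_]; last by rewrite mul0r.
by have := leq_ord i; rewrite e leqNgt kd.
Qed.

(** The degree is only bounded by d and [a] may be 0, which makes the notion multiplicative. *)
Definition has_top (d : nat) (a : C) p := (size p <= d.+1)%N /\ p`_d = a.

Lemma has_top_mul d e a b p1 p2 :
  has_top d a p1 -> has_top e b p2 -> has_top (d + e) (a * b) (p1 * p2).
Proof.
move=> [s1 <-] [s2 <-]; split.
  by apply: leq_trans (size_polyMleq _ _) _; lia.
have de : (d < (d + e).+1)%N by lia.
rewrite coefM (bigD1 (Ordinal de)) //= addKn big1 ?addr0 // => i.
rewrite -val_eqE /= neq_ltn => /orP[id|di]; last first.
  by rewrite nth_default ?mul0r // (leq_trans s1 di).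
rewrite [X in _ * X]nth_default ?mulr0 //; apply: leq_trans s2 _; rewrite /= in id *; lia.
Qed.

Lemma has_top_prod (I : finType) (d : I -> nat) (a : I -> C) (F : I -> {poly C}) :
    (forall i, has_top (d i) (a i) (F i)) ->
  has_top (\sum_i d i) (\prod_i a i) (\prod_i F i).
Proof.
move=> dF; apply: (big_ind3 has_top) => //.
  by split; rewrite ?size_poly1 // coef1.
by move=> p1 d1 a1 p2 d2 a2; apply: has_top_mul.
Qed.

Lemma has_top_linear (c : C) : has_top 1 (- c) (1 - c *: 'X).
Proof.
split; last by rewrite coefB coef1 coefZ coefX mulr1 sub0r.
apply: leq_trans (size_polyD _ _) _; rewrite geq_max size_poly1 size_polyN.
by rewrite (leq_trans (size_scale_leq _ _)) ?size_polyX.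
Qed.

End FormalPowerSeries.

(** The only analytic input; it is derived from |q| < 1 over the complex numbers in
    [complex_expr_cvg0]. *)
Definition expr_cvg0 (C : numFieldType) (q : C) : Prop :=
  ((fun N : nat => q ^+ N) @ \oo --> (0 : C))%classic.

Section QPochhammer.
Context {C : numFieldType} (q : C).
Hypothesis (q_expn_neq1 : forall k, 1 - q ^+ k.+1 != 0).

(** The finite q-binomial theorem of Gauss, arranged so that N enters only through q^N and the limit
    can be taken factor by factor. *)
Lemma finite_qpoch (b : C) N k :
  (\prod_(i < N) (1 - (b * q ^+ i) *: 'X : {poly C}))`_k
  = b ^+ k * \prod_(i < k) ((q ^+ N - q ^+ i) / (1 - q ^+ i.+1)).
Proof.
elim: N k => [|N IHN] k.
  rewrite big_ord0 coef1; case: k => [|k]; first by rewrite big_ord0 mulr1.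
  by rewrite big_ord_recl subrr mul0r mul0r mulr0.
rewrite big_ord_recr /= mulrBr mulr1 -scalerAr coefB coefZ coefMX.
case: k => [|k] /=; first by rewrite !IHN !big_ord0 mulr0 subr0.
rewrite !IHN [in RHS]big_ord_recl big_ord_recr /= !exprS expr0.
have -> : \prod_(i < k) ((q * q ^+ N - q ^+ bump 0 i) / (1 - q * q ^+ bump 0 i))
  = q ^+ k * (\prod_(i < k) (q ^+ N - q ^+ i)) / \prod_(i < k) (1 - q ^+ i.+2).
  have -> : q ^+ k * \prod_(i < k) (q ^+ N - q ^+ i) = \prod_(i < k) (q * (q ^+ N - q ^+ i)).
    by rewrite big_split /= prodr_const card_ord.
  rewrite -prodf_div; by apply: eq_bigr => i _; rewrite /= -!exprS mulrBr -!exprS.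
have E : (1 - q * 1) * \prod_(i < k) (1 - q ^+ i.+2)
       = (\prod_(i < k) (1 - q ^+ i.+1)) * (1 - q ^+ k.+1).
  rewrite -(big_ord_recr k (fun i => 1 - q ^+ i.+1)) big_ord_recl /= mulr1 expr1.
  by congr (_ * _); apply: eq_bigr.
rewrite prodf_div; move: E; set P := \prod_(i < k) (q ^+ N - q ^+ i).
have := q_expn_neq1 0; rewrite exprS expr0.
have : \prod_(i < k) (1 - q ^+ i.+1) != 0 by apply/prodf_neq0.
have : \prod_(i < k) (1 - q ^+ i.+2) != 0 by apply/prodf_neq0.
have := q_expn_neq1 k; rewrite exprS.
move: (\prod_(i < k) (1 - q ^+ i.+1)) (\prod_(i < k) (1 - q ^+ i.+2)) (q ^+ k) (q ^+ N).
move=> A B qk qN nk nB nA n1 E.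
have -> : A = (1 - q * 1) * B / (1 - q * qk) by rewrite E mulfK.
by field; rewrite mulr1 in n1; rewrite n1 nB nk.
Qed.

Hypothesis (q_cvg0 : expr_cvg0 q).

(** Euler's expansion: the coefficient is (-1)^k q^(k(k-1)/2) / ((1 - q) ... (1 - q^k)). *)
Definition qpoch_coef : fps C := fun k => \prod_(i < k) (- q ^+ i / (1 - q ^+ i.+1)).

Lemma qpochE b : qpoch q b = fps_scale b qpoch_coef.
Proof.
apply/funext => k; rewrite /qpoch /fps_scale.
under eq_fun do rewrite finite_qpoch.
apply: (cvg_lim (@norm_hausdorff _ _)); apply: cvgMl_tmp.
rewrite /qpoch_coef; elim: k => [|k IHk].
  by rewrite big_ord0; under eq_fun do rewrite big_ord0; exact: cvg_cst.
rewrite big_ord_recr /=; under eq_fun do rewrite big_ord_recr /=.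
apply: cvgM => //; apply: cvgMr_tmp; rewrite -[X in (_ --> X)%classic]sub0r.
apply: cvgB; [exact: q_cvg0 | exact: cvg_cst].
Qed.

Lemma qpoch_coef0 : qpoch_coef 0%N = 1.
Proof. by rewrite /qpoch_coef big_ord0. Qed.

Lemma qpoch0 b : qpoch q b 0%N = 1.
Proof. by rewrite qpochE /fps_scale mul1r qpoch_coef0. Qed.

Lemma qpoch_shift b : qpoch q b
  = fps_mul (fps_of_poly (1 - b *: 'X)) (qpoch q (b * q)).
Proof.
apply/funext => -[|k].
  rewrite fps_mul_coef0 !qpoch0 /fps_of_poly coefB coef1 coefZ coefX.
  by rewrite mulr0 subr0 mulr1.
rewrite /fps_mul big_ord_recl big_ord_recl big1 => [|i _].
  rewrite /fps_of_poly !coefB !coef1 !coefZ !coefX /= !qpochE /fps_scale.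
  rewrite subn0 subn1 /= mulr1 mulr0 subr0 mul1r addr0 sub0r /qpoch_coef big_ord_recr /=.
  rewrite !exprMn !exprS; have := q_expn_neq1 k; rewrite exprS.
  by move: (\prod_(i < k) _) (q ^+ k) (b ^+ k) => A B D nz; field.
by rewrite /fps_of_poly coefB coef1 coefZ coefX !lift0 /= mulr0 subr0 mul0r.
Qed.

Lemma qpoch_ratio b e : fps_mul (qpoch q b) (fps_inv (qpoch q (b * q ^+ e)))
  = fps_of_poly (\prod_(j < e) (1 - (b * q ^+ j) *: 'X)).
Proof.
suff -> : qpoch q b = fps_mul (fps_of_poly (\prod_(j < e) (1 - (b * q ^+ j) *: 'X)))
                              (qpoch q (b * q ^+ e)).
  rewrite -fps_mulA fps_mulV ?qpoch0 ?oner_neq0 //.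
  exact: fps_mulr1.
elim: e => [|e IHe]; first by rewrite big_ord0 fps_of_poly1 fps_mul1 mulr1.
by rewrite big_ord_recr fps_of_polyM -fps_mulA exprSr mulrA -qpoch_shift.
Qed.

End QPochhammer.

(** * Power series whose coefficients are polynomials in x of controlled degree *)

Section PolynomialFamilies.
Context {C : fieldType} {n : nat}.

Definition poly_family (F : ('I_n -> C) -> fps C) := forall k,
  exists2 p : mpoly n C, (mmeasure mdeg p <= k.+1)%N & forall x, F x k = meval x p.

Lemma poly_family_const f : poly_family (fun=> f).
Proof.
move=> k; exists (mpolyC n (f k)) => [|x]; last by rewrite mevalC.
by rewrite mmeasureC; case: (_ != _).
Qed.

Lemma poly_family_scale f i : poly_family (fun x => fps_scale (x i) f).
Proof.
move=> k; exists (f k *: mpolyX C (mnm_muln (mnm1 i) k)) => [|x].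
  by apply: leq_trans (mmeasureZ_le _ _ _) _; rewrite msizeX mdegMn mdeg1 mul1n.
by rewrite mevalZ -mpolyXn rmorphXn /= mevalXU mulrC.
Qed.

Lemma poly_family_mul (F G : ('I_n -> C) -> fps C) :
  poly_family F -> poly_family G -> poly_family (fun x => fps_mul (F x) (G x)).
Proof.
move=> HF HG k.
have [P HP] : {P : nat -> mpoly n C & forall k,
    (msize (P k) <= k.+1)%N /\ forall x, F x k = meval x (P k)}.
  by apply: (@choice _ _ (fun k p => (msize p <= k.+1)%N /\ forall x, F x k = meval x p)) => j;
     have [p pj pE] := HF j; exists p.
have [Q HQ] : {Q : nat -> mpoly n C & forall k,
    (msize (Q k) <= k.+1)%N /\ forall x, G x k = meval x (Q k)}.
  by apply: (@choice _ _ (fun k p => (msize p <= k.+1)%N /\ forall x, G x k = meval x p)) => j;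
     have [p pj pE] := HG j; exists p.
exists (\sum_(i < k.+1) P i * Q (k - i)%N) => [|x]; last first.
  rewrite raddf_sum; apply: eq_bigr => i _ /=.
  by rewrite mevalM (HP i).2 (HQ (k - i)%N).2.
apply: (big_ind (fun p => (msize p <= k.+1)%N)) => [|p1 p2|i _].
- by rewrite mmeasure0.
- exact: msizeD_le_max.
apply: leq_trans (msizeM_le_add (HP i).1 (HQ (k - i)%N).1) _.
by have := leq_ord i; lia.
Qed.

Lemma poly_family_prod (I : finType) (F : I -> ('I_n -> C) -> fps C) :
  (forall i, poly_family (F i)) ->
  poly_family (fun x => \big[fps_mul/fps_one]_i F i x).
Proof.
move=> HF; have -> : (fun x => \big[fps_mul/fps_one]_i F i x)
    = \big[(fun G H x => fps_mul (G x) (H x))/(fun=> fps_one)]_i F i.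
  by apply/funext => x; apply: (big_ind2 (fun f G => f = G x)) => // f G g H -> ->.
apply: (big_ind poly_family) => //; first exact: poly_family_const.
by move=> G H; apply: poly_family_mul.
Qed.

End PolynomialFamilies.

Lemma complex_expr_cvg0 (R : realType) (q : R[i]) : `|q| < 1 ->
  expr_cvg0 q.
Proof.
pose r : R := Num.sqrt ((complex.Re q) ^+ 2 + (complex.Im q) ^+ 2).
have rE : `|q| = (r%:C)%C by rewrite normc_def.
rewrite rE -[1]/((1%:C)%C) ltcR => r1.
have r0 : 0 <= r by exact: sqrtr_ge0.
have := @cvg_expr R r; rewrite ger0_norm // => /(_ r1) rc.
apply/cvgr0Pnorm_lt => /= e; rewrite ltcE /= => /andP[/eqP ei er].
have ee : e = ((complex.Re e)%:C)%C by case: e ei er => a b /= -> _.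
move/cvgr0Pnorm_lt: rc => /(_ _ er); apply: filterS => N.
rewrite normrX ger0_norm // normrX rE ee => rN.
by rewrite -rmorphXn ltcR.
Qed.

(** * The q-binomial theorem *)

Section BinomialTheorem.
Context {C : numFieldType} (q t : C).
Hypotheses (q_neq0 : q != 0) (t_neq0 : t != 0).
Hypothesis (qt_generic : forall a b : nat, q ^+ a * t ^+ b = 1 -> a = 0%N /\ b = 0%N).
Hypothesis (q_cvg0 : expr_cvg0 q).

Lemma q_expn_neq1 k : 1 - q ^+ k.+1 != 0.
Proof. by have := @subr1_expM_neq0 _ _ _ qt_generic k.+1 0 isT; rewrite mulr1. Qed.

Definition qpoch_quotient n (V x : 'I_n -> C) : fps C :=
  \big[fps_mul/fps_one]_(i < n) fps_mul (qpoch q (V i)) (fps_inv (qpoch q (x i))).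

Lemma qpoch_quotientE n (V x : 'I_n -> C) : qpoch_quotient V x
  = fps_mul (\big[fps_mul/fps_one]_(i < n) qpoch q (V i))
            (fps_inv (\big[fps_mul/fps_one]_(i < n) qpoch q (x i))).
Proof.
rewrite fps_inv_prod -?big_split // => i.
by rewrite qpoch0 ?oner_neq0 //; exact: q_expn_neq1.
Qed.

Lemma qpoch_quotient_poly n (V : 'I_n -> C) : poly_family (qpoch_quotient V).
Proof.
apply: poly_family_prod => i; apply: poly_family_mul; first exact: poly_family_const.
have -> : (fun x : 'I_n -> C => fps_inv (qpoch q (x i)))
        = (fun x => fps_scale (x i) (fps_inv (qpoch_coef q))).
  apply/funext => x; rewrite (qpochE q_expn_neq1 q_cvg0) fps_inv_scale //.
  by rewrite qpoch_coef0 oner_neq0.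
exact: poly_family_scale.
Qed.

(** Reordering the denominators by [s] pairs each (a V_i) symbol with a q-shift of itself, and each
    pair telescopes to a finite product. *)
Lemma qpoch_quotient_perm n (V x : 'I_n -> C) (s : 'S_n) (e : 'I_n -> nat) :
    (forall i, x (s i) = V i * q ^+ e i) ->
  exists2 p, qpoch_quotient V x = fps_of_poly p
    & has_top (\sum_i e i) (\prod_i \prod_(j < e i) - (V i * q ^+ j)) p.
Proof.
move=> xV; exists (\prod_i \prod_(j < e i) (1 - (V i * q ^+ j) *: 'X)).
  rewrite fps_of_poly_prod qpoch_quotientE fps_inv_prod; last first.
    by move=> i; rewrite qpoch0 ?oner_neq0 //; exact: q_expn_neq1.
  rewrite [X in fps_mul _ X](reindex_inj (@perm_inj _ s)) -big_split /=.
  by apply: eq_bigr => i _; rewrite xV qpoch_ratio //; exact: q_expn_neq1.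
apply: has_top_prod => i.
have := @has_top_prod C 'I_(e i) (fun=> 1%N) (fun j => - (V i * q ^+ j))
   (fun j => 1 - (V i * q ^+ j) *: 'X) (fun j => has_top_linear _).
by rewrite sum1_card card_ord.
Qed.

Context {m : nat}.
Implicit Types (u v w : multinom m.+1).

Local Notation sp := (spectral q t).
Local Notation nM := (norm_interp_macdonald q t).
Local Notation weight := (spectral_weight q t).

(** Positions are matched by rank. The factors left over for v_i <= j < w_(s i) are exactly those of
    the weight of w missing from the weight of v. *)
Lemma qpoch_quotient_spectral v w : mnm_dom v w ->
  exists p, [/\ (mdeg v <= mdeg w)%N, qpoch_quotient (sp v) (sp w) = fps_of_poly p
    & has_top (mdeg w - mdeg v) (weight w / weight v) p].
Proof.
move/mnm_dom_perm => [s [vw kE]].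
have [|p pE] := @qpoch_quotient_perm _ (sp v) (sp w) s (fun i => w (s i) - v i)%N.
  by move=> i; rewrite /spectral -kE mulrAC -exprD subnKC.
rewrite sumnB //.
have <- : mdeg w = (\sum_i w (s i))%N by rewrite mdegE (reindex_inj (@perm_inj _ s)).
rewrite -mdegE; set l := (\prod_i _); have -> : l = weight w / weight v.
  apply: (canRL (mulfK (spectral_weight_neq0 q_neq0 t_neq0 v))).
  rewrite /spectral_weight [RHS](reindex_inj (@perm_inj _ s)) -big_split /=.
  apply: eq_bigr => i _; rewrite -[in RHS](subnKC (vw i)) big_split_ord mulrC /=.
  rewrite -kE; congr (_ * _); apply: eq_bigr => j _.
  by rewrite /spectral exprD mulrAC.
move=> pt; exists p; split=> //.
by rewrite !mdegE [leqRHS](reindex_inj (@perm_inj _ s)); apply: leq_sum.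
Qed.

Lemma q_binomial v (x : 'I_m.+1 -> C) :
  fps_sum_multinom (fun u => qbinom q t u v * meval x (nM u))
  = fps_mul (fps_monomial (meval x (nM v)) (mdeg v)) (qpoch_quotient (sp v) x).
Proof.
apply/funext => k; rewrite fps_monomial_mul /fps_sum_multinom.
pose P := \sum_(u : bmultinom m.+1 k.+1 | mdeg u == k) qbinom q t u v *: nM u.
have PE y : \sum_(u : bmultinom m.+1 k.+1 | mdeg u == k) qbinom q t u v * meval y (nM u)
            = meval y P.
  by rewrite /P raddf_sum; apply: eq_bigr => u _ /=; rewrite [RHS]mevalZ.
have nMP u := norm_interp_macdonaldP q_neq0 t_neq0 qt_generic u.
have P_size : (msize P <= k.+1)%N.
  apply: (big_ind (fun p => (msize p <= k.+1)%N)) => [|p1 p2|b /eqP eb].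
  - by rewrite mmeasure0.
  - exact: msizeD_le_max.
  have [[bd _] _] := nMP b.
  by apply: msizeZ_le_trans; apply: leq_trans bd _; rewrite eb.
(* The product side has degree at most k: |v| from M_v and k - |v| from the quotient. *)
have [Q [Q_size QE]] : exists Q : mpoly m.+1 C, (msize Q <= k.+1)%N /\ forall y,
    (if (mdeg v <= k)%N then meval y (nM v) * qpoch_quotient (sp v) y (k - mdeg v)%N else 0)
    = meval y Q.
  case: leqP => [vk|_]; last by exists 0; rewrite mmeasure0; split=> // z; rewrite meval0.
  have [g gd gE] := @qpoch_quotient_poly _ (sp v) (k - mdeg v)%N.
  exists (nM v * g); split=> [|z]; last by rewrite mevalM gE.
  have -> : k.+1 = (mdeg v + (k - mdeg v).+1)%N by lia.
  by apply: msizeM_le_add gd; have [[]] := nMP v.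
rewrite PE QE; congr meval; apply/eqP; rewrite -subr_eq0; apply/eqP.
apply: (unisolvent q_neq0 t_neq0 qt_generic (d := k.+1)) => [|w].
  by rewrite msizeD_le_max // mmeasureN.
rewrite ltnS mevalB -PE -QE => wk.
(* As |w| <= k = |u|, a term survives at <w> only for u = w. *)
have -> : \sum_(u : bmultinom m.+1 k.+1 | mdeg u == k) qbinom q t u v * meval (sp w) (nM u)
  = if mdeg w == k then qbinom q t w v * weight w else 0.
  case: eqP => [ewk|/eqP newk].
    have wk1 : (mdeg w < k.+1)%N by rewrite ewk.
    rewrite (bigD1 (BMultinom wk1)) ?ewk //= (nMP w).2 big1 ?addr0 // => u /andP[/eqP eu uw].
    have [[_ pv] _] := nMP u; rewrite pv ?mulr0 // ?eu ?ewk //.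
    by rewrite eq_sym; apply: contra_neq uw => e; apply: val_inj.
  rewrite big1 // => u /eqP eu; have [[_ pv] _] := nMP u.
  rewrite pv ?mulr0 ?eu //; by apply: contraNneq newk => ->; rewrite eu.
rewrite /qbinom (nMP v).2.
have [e0|ne0] := eqVneq (meval (sp w) (nM v)) 0.
  by rewrite e0 !mul0r !if_same subrr.
have := extra_vanishing q_neq0 t_neq0 qt_generic (nMP v).1 ne0.
case/qpoch_quotient_spectral => p [vw -> [p_size p_top]].
(* For |w| = k the coefficient of a^(k - |v|) is the top one, a ratio of weights; for |w| < k it
   lies beyond the degree |w| - |v|. *)
rewrite (leq_trans vw wk) /fps_of_poly; case: eqP => [<-|/eqP ne].
  by rewrite p_top mulrAC mulrA subrr.
by rewrite nth_default ?mulr0 ?subrr //; apply: leq_trans p_size _; lia.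
Qed.

End BinomialTheorem.

Theorem theorem8p1 (R : realType) (n : nat) (q t : R[i])
    (n_gt0 : (0 < n)%N) (q_lt1 : `|q| < 1) (q_neq0 : q != 0) (t_neq0 : t != 0)
    (qt_generic : forall a b : nat, q ^+ a * t ^+ b = 1 -> a = 0%N /\ b = 0%N)
    (v : multinom n) (x : 'I_n -> R[i]) :
  (fps_sum_multinom
     (fun u => qbinom q t u v * meval x (norm_interp_macdonald q t u))
   =1 fps_mul
        (fps_monomial (meval x (norm_interp_macdonald q t v)) (mdeg v))
        (\big[fps_mul/fps_one]_(i < n)
            fps_mul (qpoch q (spectral q t v i)) (fps_inv (qpoch q (x i)))))
  /\
  (fps_mul
     (fps_monomial (meval x (norm_interp_macdonald q t v)) (mdeg v))
     (\big[fps_mul/fps_one]_(i < n)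
         fps_mul (qpoch q (spectral q t v i)) (fps_inv (qpoch q (x i))))
   =1 fps_mul
        (fps_monomial (meval x (norm_interp_macdonald q t v)) (mdeg v))
        (sigma q [seq x i | i : 'I_n] [seq spectral q t v i | i : 'I_n])).
Proof.
case: n n_gt0 v x => // m _ v x; have q_cvg0 := complex_expr_cvg0 q_lt1.
split=> k.
  by rewrite (q_binomial q_neq0 t_neq0 qt_generic q_cvg0).
have := qpoch_quotientE qt_generic q_cvg0 (spectral q t v) x.
by rewrite /qpoch_quotient /sigma => ->; rewrite !big_image.
Qed.
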